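(* Let $A$ be a finite abelian group. Every irreducible representation of $C(A)$ is isomorphic to $\widetilde\Pi(u,\sigma)$ for a unique affine parameter $(u,\sigma)$. In particular, $$\dim\widetilde\Pi(u,\sigma)=[\mathrm{Sp}(V_A):\mathrm{Sp}(V_A)_u]\,\dim\sigma .$$
   Context: **Setting.** $A$ is a finite abelian group, written additively; $\widehat{A}=\mathrm{Hom}(A,U(1))$; $V_A=A\oplus\widehat{A}$ (written additively); $\widehat{V_A}=\mathrm{Hom}(V_A,U(1))$. Put $\beta_A((a,\chi),(b,\psi))=\chi(b)$ and $\omega_A(u,v)=\beta_A(u,v)\beta_A(v,u)^{-1}$; $\mathrm{Sp}(V_A)=\{T\in\mathrm{Aut}(V_A):\omega_A(Tu,Tv)=\omega_A(u,v)\ \forall u,v\}$. All representations are finite-dimensional over $\mathbb{C}$; $\mathrm{Irr}(G)$ is the set of irreducible representations (or characters) of $G$. **Projective Clifford group.** Let $\mathcal{H}=\mathbb{C}[A]$ with orthonormal basis $|b\rangle$, $b\in A$; for $v=(a,\chi)\in V_A$ let $W_v|b\rangle=\chi(b)|a+b\rangle$; $H(A)=\{zW_v:z\in U(1),v\in V_A\}$ and $C(A)=N_{U(\mathcal{H})}(H(A))/(U(1)\cdot I)$. Throughout, $C(A)$ is identified (by a known isomorphism) with the group of pairs $(T,\lambda)$, $T\in\mathrm{Aut}(V_A)$, $\lambda:V_A\to U(1)$ a function, satisfying $\lambda(u+v)\lambda(u)^{-1}\lambda(v)^{-1}=\beta_A(Tu,Tv)\beta_A(u,v)^{-1}$ for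 all $u,v$, with product $(T,\lambda)(S,\mu)=(TS,\lambda^S\mu)$, $\lambda^S(u)=\lambda(Su)$; $(T,\lambda)$ corresponds to the class of any unitary $U$ with $UW_uU^\dagger=\lambda(u)W_{Tu}$ for all $u$. Necessarily $T\in\mathrm{Sp}(V_A)$, and the projection to $\mathrm{Sp}(V_A)$ is onto (known). **Affine symplectic group and functor $\mathcal{F}$.** $\mathrm{ASp}(A)=\{(T,\chi):T\in\mathrm{Sp}(V_A),\chi\in\widehat{V_A}\}$ with $(T,\chi)(S,\psi)=(TS,\chi^S\psi)$, $\chi^S(v)=\chi(Sv)$. For a representation $(U,\pi)$ of $\mathrm{ASp}(A)$ put $U_v=\{\xi\in U:\pi(\mathrm{id},\chi)\xi=\chi(v)\xi\ \forall\chi\in\widehat{V_A}\}$ and $\rho(T)=\pi(T,1)$; then $U=\bigoplus_{v\in V_A}U_v$ and $\rho(T)U_v\subseteq U_{Tv}$. $\mathcal{F}(U)$ is the same vector space with $C(A)$-action $(T,\lambda)\cdot\xi=\lambda(v)\rho(T)\xi$ for $\xi\in U_v$. **Parameters.** For $u\in V_A$: $\mathrm{Sp}(V_A)_u=\mathrm{Stab}_{\mathrm{Sp}(V_A)}(u)$ and $\mathrm{ASp}(A)_u=\mathrm{Sp}(V_A)_u\ltimes\widehat{V_A}$. For $\sigma\in\mathrm{Irr}(\mathrm{Sp}(V_A)_u)$ put $\widetilde\sigma_u(T,\chi)=\chi(u)\sigma(T)$ on $\mathrm{ASp}(A)_u$, $\Pi(u,\sigma)=\mathrm{Ind}_{\mathrm{ASp}(A)_u}^{\mathrm{ASp}(A)}(\widetilde\sigma_u)$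 and $\widetilde\Pi(u,\sigma)=\mathcal{F}(\Pi(u,\sigma))\in\mathrm{Rep}(C(A))$. An affine parameter is a pair $(u,\sigma)$ with $u\in V_A$, $\sigma\in\mathrm{Irr}(\mathrm{Sp}(V_A)_u)$, modulo the equivalence: $(u,\sigma)\sim(u',\sigma')$ iff there is $T\in\mathrm{Sp}(V_A)$ with $Tu=u'$ and $\sigma'\simeq{}^T\sigma$, where $({}^T\sigma)(R)=\sigma(T^{-1}RT)$ for $R\in\mathrm{Sp}(V_A)_{u'}$. *)

(* Defs.v *)
From HB Require Import structures.
From mathcomp Require Import all_boot all_order all_fingroup all_algebra.
From mathcomp Require Import all_solvable all_field all_character ring.
Set Implicit Arguments.
Unset Strict Implicit.
Unset Printing Implicit Defensive.
Import Order.TTheory GRing.Theory Num.Theory.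
Local Open Scope ring_scope.

(* Everything is done over an arbitrary C : numClosedFieldType; the field of  *)
(* complex numbers is R[i] for R : realType.                                  *)

(* Characters and the functions lambda of the Clifford group take values in   *)
(* the n-th roots of unity for a suitable n; this makes the types cdual and   *)
(* clifford below finite.                                                     *)
Section RootsOfUnity.
Variables (C : numClosedFieldType) (I : finType) (n : nat).

Definition unity_roots : seq C := sval (closed_field_poly_normal ('X^n - 1)).

Lemma mem_unity_roots (z : C) : (0 < n)%N -> z ^+ n = 1 -> z \in unity_roots.
Proof.
move=> n_gt0 zn1; rewrite /unity_roots.
case: (closed_field_poly_normal _) => rs /= Drs.
have lc1 : lead_coef ('X^n - 1 : {poly C}) = 1.
  by rewrite lead_coefDl ?lead_coefXn // size_polyN size_polyC size_polyXn oner_eq0.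
have : root ('X^n - 1 : {poly C}) z by rewrite /root !hornerE zn1 subrr.
by rewrite Drs lc1 scale1r root_prod_XsubC.
Qed.

Definition unity_index (f : {ffun I -> C}) : {ffun I -> 'I_(size unity_roots).+1} :=
  [ffun i => inord (index (f i) unity_roots)].
Definition unity_value (g : {ffun I -> 'I_(size unity_roots).+1}) : {ffun I -> C} :=
  [ffun i => nth 0 unity_roots (g i)].

Lemma unity_indexK (f : {ffun I -> C}) :
  (0 < n)%N -> (forall i, f i ^+ n = 1) -> unity_value (unity_index f) = f.
Proof.
move=> n_gt0 fn1; apply/ffunP=> i; rewrite !ffunE inordK ?ltnS ?index_size //.
by rewrite nth_index // mem_unity_roots.
Qed.
End RootsOfUnity.

Section CharacterGroup.
Variables (C : numClosedFieldType) (A : finZmodType).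

Definition is_char (f : {ffun A -> C}) : bool :=
  [forall a, `|f a| == 1] && [forall a, forall b, f (a + b) == f a * f b].

(* Hom(A, U(1)), written additively: (chi + psi) a = chi a * psi a.           *)
Record cdual := CDual { cdual_val :> {ffun A -> C}; _ : is_char cdual_val }.

HB.instance Definition _ := [isSub for cdual_val].
HB.instance Definition _ := [Choice of cdual by <:].

Implicit Types chi psi : cdual.

Lemma is_charP (f : {ffun A -> C}) :
  reflect ((forall a, `|f a| = 1) /\ forall a b, f (a + b) = f a * f b)
          (is_char f).
Proof.
apply: (iffP andP) => [[/forallP f1 /forallP fM]|[f1 fM]]; split.
- by move=> a; apply/eqP.
- by move=> a b; apply/eqP/(forallP (fM a)).
- by apply/forallP=> a; apply/eqP.
- by apply/forallP=> a; apply/forallP=> b; apply/eqP.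
Qed.

Lemma cdual_norm chi a : `|chi a| = 1.
Proof. by case: chi => f /= /is_charP[]. Qed.

Lemma cdualD chi a b : chi (a + b) = chi a * chi b.
Proof. by case: chi => f /= /is_charP[]. Qed.

Lemma cdual_neq0 chi a : chi a != 0.
Proof. by rewrite -normr_gt0 cdual_norm. Qed.

Lemma cdual0 chi : chi 0 = 1.
Proof. by apply: (mulfI (cdual_neq0 chi 0)); rewrite -cdualD addr0 mulr1. Qed.

Lemma cdualN chi a : chi (- a) = (chi a)^-1.
Proof.
apply: (mulfI (cdual_neq0 chi a)).
by rewrite -cdualD subrr cdual0 divff ?cdual_neq0.
Qed.

Lemma cdualMn chi a k : chi (a *+ k) = chi a ^+ k.
Proof. by elim: k => [|k IH]; rewrite ?cdual0 // mulrS cdualD IH exprS. Qed.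

Lemma finzmod_card_mul (B : finZmodType) (b : B) : b *+ #|B| = 0.
Proof. by rewrite -FinRing.zmodXgE -cardsT expg_cardG ?inE. Qed.

Lemma cdualX1 chi a : chi a ^+ #|A| = 1.
Proof. by rewrite -cdualMn finzmod_card_mul cdual0. Qed.

Lemma finzmod_gt0 : (0 < #|A|)%N.
Proof. by apply/card_gt0P; exists 0. Qed.

Lemma cdual_pcancel :
  pcancel (fun chi => @unity_index C A #|A| chi)
          (fun g => insub (unity_value g) : option cdual).
Proof.
by move=> chi; rewrite unity_indexK ?finzmod_gt0 ?valK //; apply: cdualX1.
Qed.

HB.instance Definition _ : isCountable cdual := PCanIsCountable cdual_pcancel.
HB.instance Definition _ : isFinite cdual := PCanIsFinite cdual_pcancel.

Lemma cdualP chi psi : chi =1 psi -> chi = psi.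
Proof. by move=> e; apply/val_inj/ffunP. Qed.

Fact cdual_add_subproof chi psi : is_char [ffun a => chi a * psi a].
Proof.
apply/is_charP; split=> [a|a b]; rewrite !ffunE ?normrM ?cdual_norm ?mulr1 //.
by rewrite !cdualD mulrACA.
Qed.
Definition cdual_add chi psi := CDual (cdual_add_subproof chi psi).

Fact cdual_zero_subproof : is_char [ffun=> 1].
Proof. by apply/is_charP; split=> [a|a b]; rewrite !ffunE ?normr1 ?mulr1. Qed.
Definition cdual_zero := CDual cdual_zero_subproof.

Fact cdual_opp_subproof chi : is_char [ffun a => (chi a)^-1].
Proof.
apply/is_charP; split=> [a|a b]; rewrite !ffunE ?normfV ?cdual_norm ?invr1 //.
by rewrite cdualD invfM.
Qed.
Definition cdual_opp chi := CDual (cdual_opp_subproof chi).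

Fact cdual_addA : associative cdual_add.
Proof. by move=> f g h; apply: cdualP => a; rewrite !ffunE mulrA. Qed.
Fact cdual_addC : commutative cdual_add.
Proof. by move=> f g; apply: cdualP => a; rewrite !ffunE mulrC. Qed.
Fact cdual_add0 : left_id cdual_zero cdual_add.
Proof. by move=> f; apply: cdualP => a; rewrite !ffunE mul1r. Qed.
Fact cdual_addN : left_inverse cdual_zero cdual_opp cdual_add.
Proof. by move=> f; apply: cdualP => a; rewrite !ffunE mulVf ?cdual_neq0. Qed.

HB.instance Definition _ :=
  GRing.isZmodule.Build cdual cdual_addA cdual_addC cdual_add0 cdual_addN.

Lemma cdual_addE chi psi a : (chi + psi) a = chi a * psi a.
Proof. by rewrite ffunE. Qed.
Lemma cdual_zeroE a : (0 : cdual) a = 1.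
Proof. by rewrite ffunE. Qed.
Lemma cdual_oppE chi a : (- chi) a = (chi a)^-1.
Proof. by rewrite ffunE. Qed.

End CharacterGroup.

Section Symplectic.
Variables (C : numClosedFieldType) (A : finZmodType).

Definition phase : Type := (A * cdual C A)%type.
HB.instance Definition _ := Finite.on phase.
HB.instance Definition _ := GRing.Zmodule.on phase.

Implicit Types u v w : phase.

Definition beta u v : C := u.2 v.1.
Definition omega u v : C := beta u v * (beta v u)^-1.

Lemma beta_norm u v : `|beta u v| = 1. Proof. exact: cdual_norm. Qed.
Lemma beta_neq0 u v : beta u v != 0. Proof. exact: cdual_neq0. Qed.
Lemma betaX1 u v : beta u v ^+ #|A| = 1. Proof. exact: cdualX1. Qed.

Definition is_additive (T : {perm phase}) : bool :=
  [forall u, forall v, T (u + v) == T u + T v].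

Lemma is_additiveP (T : {perm phase}) :
  reflect (forall u v, T (u + v) = T u + T v) (is_additive T).
Proof.
by apply: (iffP 'forall_forallP) => TD u v; apply/eqP/TD.
Qed.

(* The library's product on {perm _} is (S * T) v = T (S v), whereas symp and *)
(* clifford use (T * S) v = T (S v); hence the reversal in symp_mul, cl_mul.  *)
Definition is_symp (T : {perm phase}) : bool :=
  is_additive T && [forall u, forall v, omega (T u) (T v) == omega u v].

Record symp := Symp { symp_perm :> {perm phase}; _ : is_symp symp_perm }.

HB.instance Definition _ := [isSub for symp_perm].
HB.instance Definition _ := [Finite of symp by <:].

Lemma is_sympP (T : {perm phase}) :
  reflect ((forall u v, T (u + v) = T u + T v) /\
           (forall u v, omega (T u) (T v) = omega u v)) (is_symp T).
Proof.
apply: (iffP andP) => [[/is_additiveP TD /'forall_forallP To]|[TD To]]; split=> //.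
- by move=> u v; apply/eqP/To.
- exact/is_additiveP.
- by apply/'forall_forallP => u v; apply/eqP/To.
Qed.

Lemma sympD (T : symp) u v : T (u + v) = T u + T v.
Proof. by case: T => T /= /is_sympP[]. Qed.
Lemma symp_omega (T : symp) u v : omega (T u) (T v) = omega u v.
Proof. by case: T => T /= /is_sympP[]. Qed.
Lemma sympP (S T : symp) : S =1 T -> S = T.
Proof. by move=> e; apply/val_inj/permP. Qed.

Fact symp_mul_subproof (T S : symp) : is_symp (val S * val T)%g.
Proof.
by apply/is_sympP; split=> u v; rewrite !permM ?sympD ?symp_omega.
Qed.
Definition symp_mul (T S : symp) : symp := Symp (symp_mul_subproof T S).

Fact symp_one_subproof : is_symp 1%g.
Proof. by apply/is_sympP; split=> u v; rewrite !perm1. Qed.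
Definition symp_one : symp := Symp symp_one_subproof.

Fact symp_inv_subproof (T : symp) : is_symp (val T)^-1%g.
Proof.
apply/is_sympP; split=> u v.
  by apply: (@perm_inj _ (val T)); rewrite sympD !permKV.
by rewrite -(symp_omega T) !permKV.
Qed.
Definition symp_inv (T : symp) : symp := Symp (symp_inv_subproof T).

Fact symp_mulA : associative symp_mul.
Proof. by move=> T S R; apply: val_inj; rewrite /= mulgA. Qed.
Fact symp_mul1 : left_id symp_one symp_mul.
Proof. by move=> T; apply: val_inj; rewrite /= mulg1. Qed.
Fact symp_mulV : left_inverse symp_one symp_inv symp_mul.
Proof. by move=> T; apply: val_inj; rewrite /= mulgV. Qed.

HB.instance Definition _ :=
  Finite_isGroup.Build symp symp_mulA symp_mul1 symp_mulV.

Lemma sympM (T S : symp) v : (T * S)%g v = T (S v).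
Proof. by rewrite permM. Qed.
Lemma symp1 v : (1%g : symp) v = v.
Proof. by rewrite perm1. Qed.
Lemma sympK (T : symp) : cancel T (T^-1)%g.
Proof. by move=> v; rewrite -sympM mulVg symp1. Qed.
Lemma sympKV (T : symp) : cancel (T^-1)%g T.
Proof. by move=> v; rewrite -sympM mulgV symp1. Qed.

Section Pullback.
Variables (chi : cdual C phase) (S : symp).
Fact pullback_subproof : is_char [ffun v => chi (S v)].
Proof.
apply/is_charP; split=> [u|u v]; rewrite !ffunE ?cdual_norm //.
by rewrite sympD cdualD.
Qed.
Definition pullback : cdual C phase := CDual pullback_subproof.
Lemma pullbackE v : pullback v = chi (S v). Proof. by rewrite ffunE. Qed.
End Pullback.

Record affsp := AffSp { as_symp : symp; as_char : cdual C phase }.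

Definition affsp_pair (g : affsp) := (as_symp g, as_char g).
Fact affsp_pairK : cancel affsp_pair (fun p => AffSp p.1 p.2).
Proof. by case. Qed.
HB.instance Definition _ := Finite.copy affsp (can_type affsp_pairK).

Definition affsp_mul (g h : affsp) : affsp :=
  AffSp (as_symp g * as_symp h)%g (pullback (as_char g) (as_symp h) + as_char h).
Definition affsp_one : affsp := AffSp 1%g 0.
Definition affsp_inv (g : affsp) : affsp :=
  AffSp (as_symp g)^-1%g (- pullback (as_char g) (as_symp g)^-1%g).

Fact affsp_mulA : associative affsp_mul.
Proof.
case=> T x [S y] [R z]; rewrite /affsp_mul /= mulgA; congr AffSp.
by apply: cdualP => v; rewrite !(cdual_addE, pullbackE) sympM mulrA.
Qed.
Fact affsp_mul1 : left_id affsp_one affsp_mul.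
Proof.
case=> T x; rewrite /affsp_mul /= mul1g; congr AffSp.
by apply: cdualP => v; rewrite cdual_addE pullbackE cdual_zeroE mul1r.
Qed.
Fact affsp_mulV : left_inverse affsp_one affsp_inv affsp_mul.
Proof.
case=> T x; rewrite /affsp_mul /= mulVg; congr AffSp.
apply: cdualP => v; rewrite cdual_addE pullbackE cdual_oppE pullbackE sympK.
by rewrite cdual_zeroE mulVf ?cdual_neq0.
Qed.

HB.instance Definition _ :=
  Finite_isGroup.Build affsp affsp_mulA affsp_mul1 affsp_mulV.

Lemma affspM (g h : affsp) : (g * h)%g = affsp_mul g h. Proof. by []. Qed.

(* Elements are the pairs (T, lambda); (T, lambda) stands for the class, up   *)
(* to a phase, of the unitaries U with U W_u U^* = lambda(u) W_(T u).         *)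
Definition is_clifford (c : {perm phase} * {ffun phase -> C}) : bool :=
  [&& is_additive c.1, [forall u, `|c.2 u| == 1]
    & [forall u, forall v, c.2 (u + v) * (c.2 u)^-1 * (c.2 v)^-1 ==
                           beta (c.1 u) (c.1 v) * (beta u v)^-1]].

Record clifford := Clifford {
  cl_pair : {perm phase} * {ffun phase -> C};
  _ : is_clifford cl_pair
}.

HB.instance Definition _ := [isSub for cl_pair].
HB.instance Definition _ := [Choice of clifford by <:].

Definition cl_aut (c : clifford) : {perm phase} := (cl_pair c).1.
Definition cl_phase (c : clifford) : {ffun phase -> C} := (cl_pair c).2.

Lemma is_cliffordP (T : {perm phase}) (l : {ffun phase -> C}) :
  reflect [/\ forall u v, T (u + v) = T u + T v, forall u, `|l u| = 1
            & forall u v, l (u + v) =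
                beta (T u) (T v) * (beta u v)^-1 * (l u * l v)]
          (is_clifford (T, l)).
Proof.
have e u v : `|l u| = 1 -> `|l v| = 1 ->
    (l (u + v) * (l u)^-1 * (l v)^-1 == beta (T u) (T v) * (beta u v)^-1) =
    (l (u + v) == beta (T u) (T v) * (beta u v)^-1 * (l u * l v)).
  move=> lu lv; have lu0 : l u != 0 by rewrite -normr_gt0 lu.
  have lv0 : l v != 0 by rewrite -normr_gt0 lv.
  by rewrite -mulrA -invfM -(inj_eq (mulIf (mulf_neq0 lu0 lv0))) divfK ?mulf_neq0.
apply: (iffP and3P) => /= [[/is_additiveP TD /forallP l1 /'forall_forallP lc]|[TD l1 lc]].
  have l1' u : `|l u| = 1 by apply/eqP.
  by split=> // u v; apply/eqP; rewrite -e //; apply: lc.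
split; first exact/is_additiveP.
  by apply/forallP=> u; apply/eqP.
by apply/'forall_forallP => u v; rewrite e //; apply/eqP.
Qed.

Section CliffordTheory.
Variable c : clifford.

Lemma clP : [/\ forall u v, cl_aut c (u + v) = cl_aut c u + cl_aut c v,
                forall u, `|cl_phase c u| = 1
              & forall u v, cl_phase c (u + v) =
                  beta (cl_aut c u) (cl_aut c v) * (beta u v)^-1 *
                  (cl_phase c u * cl_phase c v)].
Proof. by apply/is_cliffordP; case: c => -[T l]. Qed.

Lemma cl_autD u v : cl_aut c (u + v) = cl_aut c u + cl_aut c v.
Proof. by case: clP. Qed.
Lemma cl_phase_norm u : `|cl_phase c u| = 1.
Proof. by case: clP. Qed.
Lemma cl_phaseD u v : cl_phase c (u + v) =
  beta (cl_aut c u) (cl_aut c v) * (beta u v)^-1 * (cl_phase c u * cl_phase c v).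
Proof. by case: clP. Qed.
Lemma cl_phase_neq0 u : cl_phase c u != 0.
Proof. by rewrite -normr_gt0 cl_phase_norm. Qed.

Fact cl_symp_subproof : is_symp (cl_aut c).
Proof.
apply/is_sympP; split=> [|u v]; first exact: cl_autD.
have := cl_phaseD u v; rewrite addrC cl_phaseD (mulrC (cl_phase c v)).
move/(mulIf (mulf_neq0 (cl_phase_neq0 u) (cl_phase_neq0 v))) => e.
rewrite /omega -[beta (cl_aut c u) _](divfK (beta_neq0 u v)) -e.
by field; rewrite !beta_neq0.
Qed.
Definition cl_symp : symp := Symp cl_symp_subproof.
End CliffordTheory.

Lemma cl_sympE c u : cl_symp c u = cl_aut c u. Proof. by []. Qed.

Lemma cl_phaseX1 c u : cl_phase c u ^+ (#|A| * #|{: phase}|) = 1.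
Proof.
have lD v w : cl_phase c (v + w) ^+ #|A| = cl_phase c v ^+ #|A| * cl_phase c w ^+ #|A|.
  by rewrite cl_phaseD !exprMn exprVn !betaX1 invr1 !mul1r.
have l0 : cl_phase c 0 ^+ #|A| = 1.
  apply: (mulfI (expf_neq0 #|A| (cl_phase_neq0 c 0))).
  by rewrite -lD addr0 mulr1.
have lMn k : cl_phase c (u *+ k) ^+ #|A| = (cl_phase c u ^+ #|A|) ^+ k.
  by elim: k => [|k IH]; rewrite ?mulr0n // mulrS lD IH exprS.
by rewrite exprM -lMn finzmod_card_mul.
Qed.

Let expo := (#|A| * #|{: phase}|)%N.

Fact cl_pcancel :
  pcancel (fun c => (cl_aut c, @unity_index C phase expo (cl_phase c)))
          (fun p => insub (p.1, unity_value p.2) : option clifford).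
Proof.
move=> c /=; rewrite unity_indexK; last exact: cl_phaseX1.
  by case: c => -[T l] Tl; rewrite /cl_aut /cl_phase /= (valK (Clifford Tl)).
by rewrite muln_gt0 !finzmod_gt0.
Qed.

HB.instance Definition _ : isCountable clifford := PCanIsCountable cl_pcancel.
HB.instance Definition _ : isFinite clifford := PCanIsFinite cl_pcancel.

Lemma cliffordP c d :
  cl_aut c =1 cl_aut d -> cl_phase c =1 cl_phase d -> c = d.
Proof.
move=> eT el; apply: val_inj; rewrite [LHS]surjective_pairing [RHS]surjective_pairing.
by congr (_, _); [apply/permP | apply/ffunP].
Qed.

Fact cl_mul_subproof (c d : clifford) :
  is_clifford ((cl_aut d * cl_aut c)%g,
               [ffun u => cl_phase c (cl_aut d u) * cl_phase d u]).
Proof.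
apply/is_cliffordP; split=> [u v|u|u v]; rewrite ?permM ?ffunE.
- by rewrite !cl_autD.
- by rewrite normrM !cl_phase_norm mulr1.
rewrite cl_autD !cl_phaseD.
set a := beta (cl_aut c _) _; set b := beta (cl_aut d u) _.
have b0 : b != 0 by apply: beta_neq0.
by field; rewrite b0 beta_neq0.
Qed.
Definition cl_mul (c d : clifford) : clifford := Clifford (cl_mul_subproof c d).

Fact cl_one_subproof : is_clifford (1%g, [ffun=> 1]).
Proof.
apply/is_cliffordP; split=> [u v|u|u v]; rewrite ?perm1 ?ffunE ?normr1 //.
by rewrite !mulr1 divff ?beta_neq0.
Qed.
Definition cl_one : clifford := Clifford cl_one_subproof.

Fact cl_inv_subproof (c : clifford) :
  is_clifford ((cl_aut c)^-1%g, [ffun u => (cl_phase c ((cl_aut c)^-1%g u))^-1]).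
Proof.
have autVD u v : (cl_aut c)^-1%g (u + v) = (cl_aut c)^-1%g u + (cl_aut c)^-1%g v.
  by apply: (@perm_inj _ (cl_aut c)); rewrite cl_autD !permKV.
apply/is_cliffordP; split=> [u v|u|u v]; rewrite ?ffunE //.
  by rewrite normfV cl_phase_norm invr1.
rewrite autVD cl_phaseD !permKV; field.
by rewrite !cl_phase_neq0 !beta_neq0.
Qed.
Definition cl_inv (c : clifford) : clifford := Clifford (cl_inv_subproof c).

Fact cl_mulA : associative cl_mul.
Proof.
move=> c d e; apply: cliffordP => u; rewrite /cl_aut /= ?mulgA //.
by rewrite /cl_phase /= !ffunE /= permM mulrA.
Qed.
Fact cl_mul1 : left_id cl_one cl_mul.
Proof.
move=> c; apply: cliffordP => u; rewrite /cl_aut /= ?mulg1 //.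
by rewrite /cl_phase /= !ffunE mul1r.
Qed.
Fact cl_mulV : left_inverse cl_one cl_inv cl_mul.
Proof.
move=> c; apply: cliffordP => u; rewrite /cl_aut /= ?mulgV //.
by rewrite /cl_phase /= !ffunE /= permK mulVf ?cl_phase_neq0.
Qed.

HB.instance Definition _ :=
  Finite_isGroup.Build clifford cl_mulA cl_mul1 cl_mulV.

Lemma cl_phaseM (c d : clifford) u :
  cl_phase (c * d)%g u = cl_phase c (cl_symp d u) * cl_phase d u.
Proof. by rewrite [LHS]ffunE. Qed.

Lemma cl_sympM (c d : clifford) : cl_symp (c * d)%g = (cl_symp c * cl_symp d)%g.
Proof. exact: val_inj. Qed.

Lemma cl_symp1 : cl_symp 1%g = 1%g.
Proof. exact: val_inj. Qed.

Section Stabiliser.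
Variable u : phase.

Definition symp_stab := [set T : symp | T u == u].
Fact symp_stab_group_set : group_set symp_stab.
Proof.
apply/group_setP; split=> [|T S]; rewrite !inE ?symp1 // => /eqP Tu /eqP Su.
by rewrite sympM Su Tu.
Qed.
Canonical symp_stab_group := Group symp_stab_group_set.

Definition affsp_stab := [set g : affsp | as_symp g \in symp_stab].
Fact affsp_stab_group_set : group_set affsp_stab.
Proof.
apply/group_setP; split=> [|g h]; first by rewrite inE group1.
by rewrite !inE => gu hu; rewrite sympM (eqP hu).
Qed.
Canonical affsp_stab_group := Group affsp_stab_group_set.

Fact inflate_subproof n (sigma : mx_representation C symp_stab_group n) :
  mx_repr affsp_stab_group (fun g => as_char g u *: sigma (as_symp g)).
Proof.
split=> [|g h]; first by rewrite cdual_zeroE scale1r repr_mx1.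
rewrite !inE => gu hu.
rewrite cdual_addE pullbackE repr_mxM ?inE // (eqP hu).
by rewrite -scalemxAl -scalemxAr scalerA.
Qed.
Definition inflate n (sigma : mx_representation C symp_stab_group n) :
  mx_representation C affsp_stab_group n :=
  MxRepresentation (inflate_subproof sigma).
End Stabiliser.

Fact twist_subproof u u' (T : symp) (Tu : T u = u') n
    (sigma : mx_representation C (symp_stab_group u) n) :
  mx_repr (symp_stab_group u') (fun R => sigma (T^-1 * R * T)%g).
Proof.
split=> [|R S]; first by rewrite mulg1 mulVg repr_mx1.
rewrite !inE => Ru Su; rewrite -repr_mxM ?inE.
- by congr (sigma _); rewrite !mulgA mulgK.
- by rewrite !sympM Tu (eqP Ru) -Tu sympK.
- by rewrite !sympM Tu (eqP Su) -Tu sympK.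
Qed.
Definition twist u u' (T : symp) (Tu : T u = u') n
    (sigma : mx_representation C (symp_stab_group u) n) :
  mx_representation C (symp_stab_group u') n :=
  MxRepresentation (twist_subproof Tu sigma).

End Symplectic.

(* Ind_H^gT sigma acts on column vectors of the direct sum of the t_j W, for  *)
(* (t_j) a transversal of the left cosets of H; the (i, j) block of the       *)
(* matrix of g is sigma (t_i^-1 g t_j) if t_i^-1 g t_j is in H, and 0 if not. *)
Section Induction.
Variables (F : fieldType) (gT : finGroupType) (H : {group gT}) (n : nat).
Variable sigma : mx_representation F H n.

Definition coset_index := 'I_#|lcosets H [set: gT]|.
Definition coset_rep (i : coset_index) : gT := repr (enum_val i).

Definition extend0 (x : gT) : 'M[F]_n := if x \in H then sigma x else 0.

Definition induced_mx (g : gT) : 'M[F]_(\sum_(i < #|lcosets H [set: gT]|) n) :=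
  \mxblock_(i, j) extend0 ((coset_rep i)^-1 * g * coset_rep j)%g.

Lemma coset_repE i : (coset_rep i *: H)%g = enum_val i.
Proof.
rewrite /coset_rep; have /lcosetsP[x _ ->] := enum_valP i.
by apply/lcoset_eqP; apply: (mem_repr x); apply: lcoset_refl.
Qed.

Lemma coset_rep_exists x : {j : coset_index | ((coset_rep j)^-1 * x)%g \in H}.
Proof.
have xH : (x *: H)%g \in lcosets H [set: gT].
  by rewrite mem_lcosets; apply/mulsgP; exists x 1%g; rewrite ?inE ?group1 ?mulg1.
exists (enum_rank_in xH (x *: H)%g); rewrite -mem_lcoset coset_repE enum_rankK_in //.
exact: lcoset_refl.
Qed.

Lemma coset_rep_inj i j : ((coset_rep i)^-1 * coset_rep j)%g \in H -> i = j.
Proof.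
rewrite -mem_lcoset => /lcoset_eqP; rewrite !coset_repE => e.
exact/enum_val_inj.
Qed.

Fact induced_subproof : mx_repr [set: gT] induced_mx.
Proof.
split=> [|x y _ _]; rewrite /induced_mx.
  rewrite -mxdiagZ; apply: eq_mxblock => i j; rewrite /extend0 mulg1.
  case: eqVneq => [->|ij].
    by rewrite mulVg group1 repr_mx1 conform_mx_id.
  by case: ifP => // /coset_rep_inj eij; rewrite eij eqxx in ij.
rewrite mul_mxblock; apply: eq_mxblock => i j.
have [k kH] := coset_rep_exists (y * coset_rep j).
rewrite (bigD1 k) //= big1 ?addr0 => [|l lk]; last first.
  rewrite [X in _ *m X]/extend0; case: ifP => [|_]; last by rewrite mulmx0.
  move=> lH; case/eqP: lk; apply: coset_rep_inj.
  rewrite -(mulgA) in lH; have := groupM lH (groupVr kH).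
  by rewrite invMg invgK -mulgA mulVKg.
rewrite /extend0 -(mulgA _ y) kH.
have -> : ((coset_rep i)^-1 * (x * y) * coset_rep j =
    ((coset_rep i)^-1 * x * coset_rep k) * ((coset_rep k)^-1 * (y * coset_rep j)))%g.
  by rewrite !mulgA mulgK.
by rewrite groupMr //; case: ifP => xH; rewrite ?mul0mx // repr_mxM.
Qed.

Definition induced_repr : mx_representation F [set: gT] _ :=
  MxRepresentation induced_subproof.
End Induction.

Section Orthogonality.
Variables (C : numClosedFieldType) (B : finZmodType).
Implicit Types (b : B) (chi : cdual C B).

Lemma finite_order_diagonalizable n (M : 'M[C]_n.+1) k :
  (0 < k)%N -> M ^+ k = 1 -> diagonalizable M.
Proof.
move=> k_gt0 Mk; apply/diagonalizableP.
have [rs Drs] := closed_field_poly_normal ('X^k - 1 : {poly C}).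
have lc1 : lead_coef ('X^k - 1 : {poly C}) = 1.
  by rewrite lead_coefDl ?lead_coefXn // size_polyN size_polyC size_polyXn oner_eq0.
rewrite lc1 scale1r in Drs; exists rs.
  rewrite -separable_prod_XsubC -Drs separable_Xn_sub_1 //.
  by rewrite pnatr_eq0 -lt0n.
rewrite -Drs; apply: mxminpoly_min.
by rewrite rmorphB rmorphXn /= horner_mx_X rmorph1 Mk subrr.
Qed.

Lemma cdual_separates b : b != 0 -> exists chi, chi b != 1.
Proof.
move=> b0.
suff sep n (rG : mx_representation C [set: B] n) :
    b \notin rker rG -> exists chi, chi b != 1.
  apply: (sep _ (regular_repr C [set: B]%G)); apply: contra b0 => kb.
  by have := subsetP (regular_mx_faithful C [set: B]%G) b kb; rewrite inE.
rewrite inE in_setT mul1mx /=.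
case: n rG => [|n] rG; first by rewrite [rG b]flatmx0 [1%:M]flatmx0 eqxx.
move=> rGb.
have rGD x y : rG (x + y) = rG x *m rG y by rewrite -repr_mxM ?inE.
have rG0 : rG 0 = 1 by apply: (repr_mx1 rG).
have rGn x k : rG (x *+ k) = rG x ^+ k.
  by elim: k => [|k IH]; rewrite ?expr0 // mulrS rGD IH exprS.
have dG x : diagonalizable (rG x).
  apply: (@finite_order_diagonalizable _ _ #|B|); first exact: finzmod_gt0.
  by rewrite -rGn finzmod_card_mul.
have [P Pu /allP Pd] : codiagonalizable [seq rG x | x <- enum B].
  apply/codiagonalizableP; split=> [M N|M] /mapP[x _ ->] //.
  by case/mapP=> y _ ->; rewrite /comm_mx -!rGD addrC.
pose D x := P *m rG x *m invmx P.
have Dd x i j : i != j -> D x i j = 0.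
  move=> ij; have /Pd /= : rG x \in [seq rG x | x <- enum B].
    by apply: map_f; rewrite mem_enum.
  by move/(diagonalizable_forP _ Pu); apply.
have DD x y : D (x + y) = D x *m D y.
  by rewrite /D rGD !mulmxA mulmxKV.
have D0 : D 0 = 1%:M by rewrite /D rG0 mulmx1 mulmxV.
have DDi x y i : D (x + y) i i = D x i i * D y i i.
  rewrite DD mxE (bigD1 i) //= big1 ?addr0 // => j ji.
  by rewrite Dd 1?eq_sym // mul0r.
have [i Dbi] : exists i, D b i i != 1.
  apply/existsP; apply: contraR rGb => /existsPn /= Db1.
  have Db : D b = 1%:M.
    apply/matrixP=> i j; rewrite [RHS]mxE; case: eqVneq => [<-|ij]; last by rewrite Dd.
    by apply/eqP; rewrite -[_ == _]negbK.
  have : invmx P *m D b *m P = 1%:M by rewrite Db mulmx1 mulVmx.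
  by rewrite /D !mulmxA mulVmx // mul1mx mulmxKV // => ->.
have DX x k : D (x *+ k) i i = D x i i ^+ k.
  elim: k => [|k IH]; first by rewrite mulr0n D0 mxE eqxx.
  by rewrite mulrS DDi IH exprS.
have chiP : is_char [ffun x => D x i i].
  apply/is_charP; split=> [x|x y]; rewrite !ffunE //.
  have : `|D x i i| ^+ #|B| = 1.
    by rewrite -normrX -DX finzmod_card_mul D0 mxE eqxx normr1.
  by move/eqP; rewrite pexpr_eq1 ?finzmod_gt0 // => /eqP.
by exists (CDual chiP); rewrite /= ffunE.
Qed.

Lemma sum_cdual_points chi : \sum_b chi b = if chi == 0 then #|B|%:R else 0.
Proof.
case: eqVneq => [->|chi0].
  by under eq_bigr do rewrite cdual_zeroE; rewrite sumr_const.
have [a chia] : exists a, chi a != 1.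
  apply/existsP; apply: contraR chi0 => /existsPn /= chi1.
  apply/eqP/cdualP => a; rewrite cdual_zeroE; apply/eqP.
  by rewrite -[_ == _]negbK.
have nz : chi a - 1 != 0 by rewrite subr_eq0.
apply: (mulfI nz); rewrite mulr0 mulrBl mul1r mulr_sumr; apply/eqP.
rewrite subr_eq0; apply/eqP; rewrite [RHS](reindex_inj (addrI a)) /=.
by apply: eq_bigr => b _; rewrite cdualD.
Qed.

Lemma sum_cdual b : \sum_chi (chi : cdual C B) b =
  if b == 0 then #|{: cdual C B}|%:R else 0.
Proof.
case: eqVneq => [->|/cdual_separates[psi psib]].
  by under eq_bigr do rewrite cdual0; rewrite sumr_const.
have nz : psi b - 1 != 0 by rewrite subr_eq0.
apply: (mulfI nz); rewrite mulr0 mulrBl mul1r mulr_sumr; apply/eqP.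
rewrite subr_eq0; apply/eqP; rewrite [RHS](reindex_inj (addrI psi)) /=.
by apply: eq_bigr => chi _; rewrite cdual_addE.
Qed.

Lemma card_cdual : #|{: cdual C B}| = #|B|.
Proof.
apply/eqP; rewrite -(eqr_nat C); apply/eqP.
have <- : \sum_(b : B) \sum_chi (chi : cdual C B) b = #|{: cdual C B}|%:R.
  rewrite (bigD1 0) //= sum_cdual eqxx big1 ?addr0 // => b b0.
  by rewrite sum_cdual (negbTE b0).
rewrite exchange_big /= (bigD1 0) // sum_cdual_points eqxx big1 => [|chi c0].
  by rewrite /= addr0.
by rewrite sum_cdual_points (negbTE c0).
Qed.
End Orthogonality.

(* Representations are homomorphisms g |-> Pi g to GL_n, here acting on       *)
(* columns from the left.  The row submodules used by mx_irreducible are the  *)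
(* annihilators of the column submodules, so irreducibility is the same.      *)
Section FunctorF.
Variables (C : numClosedFieldType) (A : finZmodType) (n : nat).
Variable Pi : mx_representation C [set: affsp C A] n.

Local Notation V := (phase C A).
Local Notation Sp := (symp C A).

Definition rho (T : Sp) : 'M[C]_n := Pi (AffSp T 0).
Definition char_op (chi : cdual C V) : 'M[C]_n := Pi (AffSp 1%g chi).

(* xi is in U_v.                                                              *)
Definition in_weight_space (v : V) (xi : 'cV[C]_n) : Prop :=
  forall chi, char_op chi *m xi = chi v *: xi.

(* The projection onto U_v along the sum of the U_w, w != v.                  *)
Definition weight_proj (v : V) : 'M[C]_n :=
  #|{: V}|%:R^-1 *: \sum_(chi : cdual C V) (chi v)^-1 *: char_op chi.

Definition functorF_mx (c : clifford C A) : 'M[C]_n :=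
  \sum_(v : V) cl_phase c v *: (rho (cl_symp c) *m weight_proj v).

Let cardV_neq0 : #|{: V}|%:R != 0 :> C.
Proof. by rewrite pnatr_eq0 -lt0n finzmod_gt0. Qed.

Lemma char_opD chi psi : char_op (chi + psi) = char_op chi *m char_op psi.
Proof.
rewrite -repr_mxM ?inE // affspM /affsp_mul /= mulg1; congr (Pi (AffSp _ _)).
by apply: cdualP => v; rewrite !cdual_addE pullbackE symp1.
Qed.

Lemma char_op0 : char_op 0 = 1%:M.
Proof. exact: (repr_mx1 Pi). Qed.

Lemma rhoM T S : rho (T * S)%g = rho T *m rho S.
Proof.
rewrite -repr_mxM ?inE // affspM /affsp_mul /=; congr (Pi (AffSp _ _)).
by apply: cdualP => v; rewrite cdual_addE pullbackE !cdual_zeroE mulr1.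
Qed.

Lemma rho1 : rho 1%g = 1%:M.
Proof. exact: (repr_mx1 Pi). Qed.

Lemma char_op_rho chi T : char_op chi *m rho T = rho T *m char_op (pullback chi T).
Proof.
rewrite -!repr_mxM ?inE // !affspM /affsp_mul /= mul1g mulg1.
congr (Pi (AffSp _ _)); apply: cdualP => v.
by rewrite !(cdual_addE, pullbackE, cdual_zeroE) mulr1 mul1r.
Qed.

Lemma char_op_proj chi v : char_op chi *m weight_proj v = chi v *: weight_proj v.
Proof.
rewrite /weight_proj -scalemxAr scalerA mulrC -scalerA; congr (_ *: _).
rewrite mulmx_sumr scaler_sumr [RHS](reindex_inj (addrI chi)) /=.
apply: eq_bigr => psi _; rewrite -scalemxAr -char_opD scalerA cdual_addE.
by rewrite invfM mulrA mulfV ?mul1r ?cdual_neq0.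
Qed.

Lemma weight_proj_in v xi : in_weight_space v (weight_proj v *m xi).
Proof. by move=> chi; rewrite mulmxA char_op_proj -scalemxAl. Qed.

Lemma weight_proj_delta v w xi : in_weight_space w xi ->
  weight_proj v *m xi = if v == w then xi else 0.
Proof.
move=> xiw; rewrite /weight_proj -scalemxAl mulmx_suml.
under eq_bigr => chi _ do
  rewrite -scalemxAl xiw scalerA mulrC -cdualN -cdualD.
rewrite -scaler_suml sum_cdual subr_eq0 [w == v]eq_sym.
case: ifP => _; last by rewrite scale0r scaler0.
by rewrite card_cdual scalerA mulVf ?scale1r.
Qed.

Lemma sum_weight_proj : \sum_v weight_proj v = 1%:M.
Proof.
rewrite -scaler_sumr exchange_big (bigD1 0) //= [X in _ + X]big1 => [|chi chi0].
  under eq_bigr do rewrite cdual_zeroE invr1 scale1r.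
  by rewrite sumr_const addr0 char_op0 -scaler_nat scalerA mulVf ?scale1r.
rewrite -scaler_suml; under eq_bigr do rewrite -cdual_oppE.
by rewrite sum_cdual_points oppr_eq0 (negbTE chi0) scale0r.
Qed.

Lemma rho_in_weight_space (T : Sp) v xi :
  in_weight_space v xi -> in_weight_space (T v) (rho T *m xi).
Proof.
by move=> xiv chi; rewrite mulmxA char_op_rho -mulmxA xiv pullbackE -scalemxAr.
Qed.

(* Together with weight_decomposition and weight_proj_in, this characterises  *)
(* functorF_mx: it is the only map acting this way on every U_v.              *)
Lemma functorF_mxE c v xi : in_weight_space v xi ->
  functorF_mx c *m xi = cl_phase c v *: (rho (cl_symp c) *m xi).
Proof.
move=> xiv; rewrite /functorF_mx mulmx_suml (bigD1 v) //= big1 ?addr0 => [|w wv].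
  by rewrite -scalemxAl -mulmxA (weight_proj_delta v xiv) eqxx.
by rewrite -scalemxAl -mulmxA (weight_proj_delta w xiv) (negbTE wv) mulmx0 scaler0.
Qed.

Lemma weight_decomposition (xi : 'cV[C]_n) : xi = \sum_v weight_proj v *m xi.
Proof. by rewrite -mulmx_suml sum_weight_proj mul1mx. Qed.

Fact functorF_subproof : mx_repr [set: clifford C A] functorF_mx.
Proof.
have ext (M N : 'M[C]_n) :
    (forall v xi, in_weight_space v xi -> M *m xi = N *m xi) -> M = N.
  move=> e; rewrite -[M]mulmx1 -[N]mulmx1 -sum_weight_proj !mulmx_sumr.
  apply: eq_bigr => v _; apply/matrixP => i j.
  have := e v _ (weight_proj_in v (delta_mx j 0)).
  by rewrite !mulmxA -!colE => /colP/(_ i); rewrite !mxE.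
split=> [|c d _ _]; apply: ext => v xi xiv.
  rewrite (functorF_mxE _ xiv) cl_symp1 rho1 mul1mx.
  by rewrite [cl_phase _ _]ffunE scale1r.
rewrite (functorF_mxE _ xiv) -mulmxA (functorF_mxE _ xiv) -scalemxAr.
rewrite (functorF_mxE _ (rho_in_weight_space _ xiv)) scalerA mulrC.
by rewrite cl_phaseM cl_sympM rhoM mulmxA [X in X *: _]mulrC mulrC.
Qed.

Definition functorF : mx_representation C [set: clifford C A] n :=
  MxRepresentation functorF_subproof.
End FunctorF.

Section AffineParameters.
Variables (C : numClosedFieldType) (A : finZmodType).

Record affine_param := AffineParam {
  ap_pt : phase C A;
  ap_rep : representation C (symp_stab_group ap_pt);
  ap_irr : mx_irreducible ap_rep
}.

Definition affine_param_equiv (p q : affine_param) : Prop :=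
  exists (T : symp C A) (Tp : T (ap_pt p) = ap_pt q),
    mx_rsim (ap_rep q) (twist Tp (ap_rep p)).

Definition affPi (p : affine_param) : representation C [set: affsp C A] :=
  Representation (induced_repr (inflate (ap_rep p))).

Definition cliffordPi (p : affine_param) : representation C [set: clifford C A] :=
  Representation (functorF (affPi p)).
End AffineParameters.

(* Main.v *)
Require Import Defs.
From mathcomp Require Import all_boot all_order all_fingroup all_algebra.
From mathcomp Require Import all_solvable all_field all_character.
From mathcomp Require Import complex reals ring.

Set Implicit Arguments.
Unset Strict Implicit.
Unset Printing Implicit Defensive.
Import Order.TTheory GRing.Theory Num.Theory.
Local Open Scope ring_scope.

(** The characters (1, chi), chi in the dual of V, form an abelian normal
    subgroup of C(A) and of ASp(A), so a representation of either group is the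
    sum of its weight spaces U_v, and an element over T maps U_v to U_(T v).
    The classification is the method of little groups for this subgroup.  That
    method wants the stabiliser of a weight to act on the weight space through
    an honest representation of Sp(V)_u; this is clear in ASp(A), which is a
    semidirect product, and C(A) is compared with ASp(A) by the functor F.

    F loses no information.  It has the same intertwiners on both sides
    (functorF_intertwine), and every representation tau of C(A) is F of one of
    ASp(A) (functorF_untwist): choose (T, lambda) in C(A) over T and let T act
    on U_v by lambda(v)^-1 tau(T, lambda).  Two choices differ by a character
    chi, which acts on U_v as the scalar chi(v), so the choice is immaterial
    and the operators multiply.  A choice exists because the factor
    beta(T u, T v) / beta(u, v) is a symmetric bicharacter, and those are
    coboundaries (symmetric_bicharacter_coboundary, cl_symp_onto).

    In the representation of ASp(A) induced from (u, sigma), the weight space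
    at v = T u is the space of vectors supported on one coset; evaluation at T
    (ind_row) identifies it with the representation of Sp(V)_v conjugate to
    sigma by T (weight_proj_ind_at, ind_row_rho).  An isomorphism between two
    induced representations respects weight spaces, so it forces the parameters
    to be equivalent (equiv_affPi_rsim).

    Conversely, let Pi be any representation of ASp(A) and S a copy of sigma in
    its weight space at u.  By Frobenius reciprocity S yields a map between the
    induced representation and Pi, and this map is injective since the
    translates of S by coset representatives lie in distinct weight spaces
    (weight_embed_free).  If F(Pi) is irreducible the map is onto, so every
    irreducible representation of C(A) is F of an induced one
    (clifford_irr_exhaustion).
    If Pi is itself induced from an equivalent parameter, such maps exist in
    both directions, so the two are isomorphic (affPi_rsim_equiv).

    Representations act on columns, but submodules and isomorphisms are handled
    through rows: a row embedding S of sigma satisfies sigma(R) S = S Pi(R). *)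

(** * Eigenprojections of a commuting family indexed by characters *)

Section Eigenprojections.
Variables (C : numClosedFieldType) (B : finZmodType).
Implicit Types (b : B) (chi : cdual C B).

(** For a representation chi |-> N chi of the dual group this is the projection
    onto the space where every N chi is the scalar chi b.  Taking N as a bare
    function lets the same theory serve the characters inside ASp(A) and those
    inside C(A). *)
Definition eigenproj m (N : cdual C B -> 'M[C]_m) b : 'M[C]_m :=
  #|{: B}|%:R^-1 *: \sum_(chi : cdual C B) (chi b)^-1 *: N chi.

(** The substitution f of characters covers two uses: f = id for an intertwiner
    of representations, and f = pullback by T for an operator lying over T,
    which then moves the eigenspace at b to the one at b' = T b. *)
Lemma eigenproj_intertwine m m' (N : cdual C B -> 'M[C]_m)
    (N' : cdual C B -> 'M[C]_m') (X : 'M_(m, m'))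
    (f : cdual C B -> cdual C B) b b' :
  injective f -> (forall chi, f chi b = chi b') ->
  (forall chi, N chi *m X = X *m N' (f chi)) ->
  eigenproj N b' *m X = X *m eigenproj N' b.
Proof.
move=> f_inj fb NX; rewrite -scalemxAl -scalemxAr; congr (_ *: _).
rewrite mulmx_suml mulmx_sumr [RHS](reindex_inj f_inj) /=.
by apply: eq_bigr => chi _; rewrite -scalemxAl NX -scalemxAr fb.
Qed.

(** The operator that is the scalar h b on the eigenspace at b.  Twisting by the
    phases of a Clifford element amounts to multiplying by such operators. *)
Definition diag_op m (N : cdual C B -> 'M[C]_m) (h : B -> C) : 'M[C]_m :=
  \sum_b h b *: eigenproj N b.

Lemma eq_diag_op m (N : cdual C B -> 'M[C]_m) h h' :
  h =1 h' -> diag_op N h = diag_op N h'.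
Proof. by move=> hh'; apply: eq_bigr => b _; rewrite hh'. Qed.

Lemma diag_op_intertwine m m' (N : cdual C B -> 'M[C]_m)
    (N' : cdual C B -> 'M[C]_m') (X : 'M_(m, m'))
    (f : cdual C B -> cdual C B) (g : B -> B) h :
  injective f -> injective g -> (forall chi b, f chi b = chi (g b)) ->
  (forall chi, N chi *m X = X *m N' (f chi)) ->
  diag_op N h *m X = X *m diag_op N' (h \o g).
Proof.
move=> f_inj g_inj fg NX; rewrite mulmx_suml mulmx_sumr (reindex_inj g_inj) /=.
apply: eq_bigr => b _; rewrite -scalemxAl -scalemxAr; congr (_ *: _).
exact: (eigenproj_intertwine f_inj).
Qed.

Section Family.
Variables (m : nat) (N : cdual C B -> 'M[C]_m).
Hypotheses (N0 : N 0 = 1%:M) (ND : forall chi psi, N (chi + psi) = N chi *m N psi).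

Local Notation P := (eigenproj N).

Let cardB_neq0 : #|{: B}|%:R != 0 :> C.
Proof. by rewrite pnatr_eq0 -lt0n finzmod_gt0. Qed.

Lemma eigenproj_char chi b : N chi *m P b = chi b *: P b.
Proof.
rewrite /eigenproj -scalemxAr scalerA mulrC -scalerA; congr (_ *: _).
rewrite mulmx_sumr scaler_sumr [RHS](reindex_inj (addrI chi)) /=.
apply: eq_bigr => psi _; rewrite -scalemxAr -ND scalerA cdual_addE.
by rewrite invfM mulrA mulfV ?mul1r ?cdual_neq0.
Qed.

Lemma char_eigenproj chi b : P b *m N chi = chi b *: P b.
Proof.
rewrite -eigenproj_char; apply: (@eigenproj_intertwine _ _ _ _ _ id) => // psi.
by rewrite -!ND addrC.
Qed.

(** Orthogonality of characters: the average of chi |-> chi (a - b) vanishes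
    unless a = b. *)
Lemma eigenrow_proj k (X : 'M_(k, m)) a b :
  (forall chi, X *m N chi = chi a *: X) ->
  X *m P b = if b == a then X else 0.
Proof.
move=> NX; rewrite -scalemxAr mulmx_sumr.
under eq_bigr => chi _ do
  rewrite -scalemxAr NX scalerA mulrC -cdualN -cdualD.
rewrite -scaler_suml sum_cdual subr_eq0 [a == b]eq_sym.
case: ifP => _; last by rewrite scale0r scaler0.
by rewrite card_cdual scalerA mulVf ?scale1r.
Qed.

Lemma mul_eigenproj a b : P a *m P b = if b == a then P a else 0.
Proof. by apply: eigenrow_proj => chi; apply: char_eigenproj. Qed.

Lemma sum_eigenproj : \sum_b P b = 1%:M.
Proof.
rewrite -scaler_sumr exchange_big (bigD1 0) //= [X in _ + X]big1 => [|chi chi0].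
  under eq_bigr do rewrite cdual_zeroE invr1 scale1r.
  by rewrite sumr_const addr0 N0 -scaler_nat scalerA mulVf ?scale1r.
rewrite -scaler_suml; under eq_bigr do rewrite -cdual_oppE.
by rewrite sum_cdual_points oppr_eq0 (negbTE chi0) scale0r.
Qed.

Lemma diag_opM f g : diag_op N f *m diag_op N g = diag_op N (fun b => f b * g b).
Proof.
rewrite mulmx_suml; apply: eq_bigr => b _; rewrite mulmx_sumr (bigD1 b) //=.
rewrite -scalemxAl -scalemxAr mul_eigenproj eqxx scalerA big1 ?addr0 // => a ab.
by rewrite -scalemxAr -scalemxAl mul_eigenproj (negbTE ab) !scaler0.
Qed.

Lemma diag_op1 : diag_op N (fun=> 1) = 1%:M.
Proof. by rewrite -sum_eigenproj; apply: eq_bigr => b _; rewrite scale1r. Qed.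

Lemma diag_op_char chi : diag_op N chi = N chi.
Proof.
rewrite -[RHS]mulmx1 -sum_eigenproj mulmx_sumr.
by apply: eq_bigr => b _; rewrite eigenproj_char.
Qed.

End Family.
End Eigenprojections.

(** * Lifting symplectic automorphisms to the Clifford group *)

Section Cocycle.
Variables (C : numClosedFieldType) (V : finZmodType) (c : V -> V -> C).
Hypotheses (c_sym : forall u v, c u v = c v u) (c_norm : forall u v, `|c u v| = 1).
Hypothesis cD : forall u v w, c (u + v) w = c u w * c v w.

(** Twist the regular representation of V by c: the matrices M u satisfy
    M u M v = c(u, v) M (u + v), and they commute because c is symmetric.  The
    eigenvalues a u on a common eigenvector obey the same rule, so l = 1 / a
    trivialises c.  They have norm 1 because |a| is multiplicative on the finite
    group V. *)
Lemma symmetric_bicharacter_coboundary : exists l : V -> C,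
  (forall u, `|l u| = 1) /\ forall u v, l (u + v) = c u v * (l u * l v).
Proof.
have c_neq0 u v : c u v != 0 by rewrite -normr_gt0 c_norm.
have c0 v : c 0 v = 1.
  by apply: (mulfI (c_neq0 0 v)); rewrite -cD addr0 mulr1.
pose M u : 'M[C]_#|V| := \matrix_i
  (c u (enum_val i) *: delta_mx 0 (enum_rank (u + enum_val i))).
have MM u v : M u *m M v = c u v *: M (u + v).
  apply/row_matrixP=> i; rewrite row_mul linearZ /= !rowK -scalemxAl -rowE rowK.
  rewrite enum_rankK !scalerA addrA [v + u]addrC cD.
  by rewrite [c v (_ + _)]c_sym cD (c_sym (enum_val i) v) mulrCA.
have n_gt0 : (0 < #|V|)%N by apply: finzmod_gt0.
have M_comm : {in [seq M u | u : V] &, forall X Y, comm_mx X Y}.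
  move=> _ _ /codomP[u ->] /codomP[v ->].
  by rewrite /comm_mx !MM c_sym addrC.
have [x x0 /allP xM] := common_eigenvector n_gt0 M_comm.
have /fin_all_exists[a xa] u : exists a, x *m M u = a *: x.
  by apply/sub_rVP/xM/codom_f.
have x_inj : injective (fun k : C => k *: x).
  move=> k l /eqP; rewrite -subr_eq0 -scalerBl scaler_eq0 (negbTE x0) orbF.
  by rewrite subr_eq0 => /eqP.
have aM u v : a u * a v = c u v * a (u + v).
  apply: x_inj; rewrite /= -[RHS]scalerA -xa scalemxAr -MM mulmxA xa -scalemxAl xa.
  by rewrite scalerA.
have a0 : a 0 = 1.
  apply: x_inj; rewrite -xa scale1r -[RHS]mulmx1; congr (_ *m _).
  apply/row_matrixP=> i; rewrite rowK c0 scale1r add0r enum_valK.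
  by rewrite row1.
have norm_aMn u k : `|a (u *+ k)| = `|a u| ^+ k.
  elim: k => [|k IH]; first by rewrite mulr0n a0 normr1.
  rewrite mulrS exprS -IH -normrM aM normrM.
  by rewrite c_norm mul1r.
have a_norm u : `|a u| = 1.
  have : `|a u| ^+ #|V| = 1 by rewrite -norm_aMn finzmod_card_mul a0 normr1.
  by move/eqP; rewrite pexpr_eq1 ?finzmod_gt0 // => /eqP.
exists (fun u => (a u)^-1); split=> [u|u v]; first by rewrite normfV a_norm invr1.
by rewrite -invfM aM invfM mulVKf.
Qed.
End Cocycle.

Section CliffordExtension.
Variables (C : numClosedFieldType) (A : finZmodType).
Local Notation V := (phase C A).
Local Notation Sp := (symp C A).
Local Notation Cl := (clifford C A).
Implicit Types (u v w : V) (T : Sp) (c d : Cl) (chi psi : cdual C V).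

Lemma betaDl u v w : beta (u + v) w = beta u w * beta v w.
Proof. exact: cdual_addE. Qed.

(** The defining condition on a phase l over T asks that
    beta(T u, T v) / beta(u, v) be the coboundary of l, and this bicharacter is
    symmetric exactly because T preserves omega. *)
Lemma cl_symp_onto T : exists c, cl_symp c == T.
Proof.
pose q u v := beta (T u) (T v) * (beta u v)^-1.
have q_sym u v : q u v = q v u.
  rewrite /q -[beta (T u) _](divfK (beta_neq0 (T v) (T u))).
  have := symp_omega T u v; rewrite /omega => ->.
  by field; rewrite !beta_neq0.
have q_norm u v : `|q u v| = 1 by rewrite normrM normfV !beta_norm divr1.
have qD u v w : q (u + v) w = q u w * q v w.
  by rewrite /q sympD !betaDl invfM mulrACA.
have [l [l_norm lD]] := symmetric_bicharacter_coboundary q_sym q_norm qD.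
have cP : is_clifford (symp_perm T, [ffun u => l u]).
  apply/is_cliffordP; split=> [u v|u|u v]; rewrite ?ffunE ?sympD //.
by exists (Clifford cP); apply/eqP/sympP.
Qed.

Definition cl_lift T : Cl := xchoose (cl_symp_onto T).

Lemma cl_liftK : cancel cl_lift (@cl_symp C A).
Proof. by move=> T; apply/eqP/(xchooseP (cl_symp_onto T)). Qed.

Fact cl_char_subproof chi : is_clifford (1%g : {perm V}, cdual_val chi).
Proof.
apply/is_cliffordP; split=> [u v|u|u v]; rewrite ?perm1 ?cdual_norm //.
by rewrite divff ?beta_neq0 // mul1r cdualD.
Qed.
Definition cl_char chi : Cl := Clifford (cl_char_subproof chi).

Lemma cl_phase_char chi v : cl_phase (cl_char chi) v = chi v.
Proof. by []. Qed.

Lemma cl_symp_char chi : cl_symp (cl_char chi) = 1%g.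
Proof. exact: val_inj. Qed.

Lemma cliffordE c d :
  cl_symp c = cl_symp d -> cl_phase c =1 cl_phase d -> c = d.
Proof. by move=> e; apply: cliffordP => v; rewrite -!cl_sympE e. Qed.

Lemma cl_phase1 v : cl_phase (1%g : Cl) v = 1.
Proof. by rewrite [LHS]ffunE. Qed.

Lemma cl_charD chi psi : cl_char (chi + psi) = (cl_char chi * cl_char psi)%g.
Proof.
apply: cliffordE => [|v]; first by rewrite cl_sympM !cl_symp_char mulg1.
by rewrite cl_phaseM !cl_phase_char cl_symp_char symp1 cdual_addE.
Qed.

Lemma cl_char0 : cl_char 0 = 1%g.
Proof.
apply: cliffordE => [|v]; first by rewrite cl_symp_char cl_symp1.
by rewrite [RHS]cl_phase1 cl_phase_char cdual_zeroE.
Qed.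

Lemma cl_charJ chi c :
  (cl_char chi * c)%g = (c * cl_char (pullback chi (cl_symp c)))%g.
Proof.
apply: cliffordE => [|v]; rewrite ?(cl_sympM, cl_phaseM) !cl_symp_char.
  by rewrite mul1g mulg1.
by rewrite symp1 !cl_phase_char pullbackE mulrC.
Qed.

(** Two phases over the same T have the same coboundary, so their quotient is a
    character: the kernel of C(A) -> Sp(V) is the dual of V. *)
Lemma same_symp_char c d : cl_symp c = cl_symp d ->
  exists chi, d = (c * cl_char chi)%g.
Proof.
move=> e; have chiP : is_char [ffun v => cl_phase d v / cl_phase c v].
  apply/is_charP; split=> [v|u v]; rewrite !ffunE.
    by rewrite normrM normfV !cl_phase_norm divr1.
  rewrite !cl_phaseD -!cl_sympE e; field.
  by rewrite !cl_phase_neq0 !beta_neq0.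
exists (CDual chiP); apply: cliffordE => [|v].
  by rewrite cl_sympM cl_symp_char mulg1.
rewrite cl_phaseM cl_symp_char symp1 cl_phase_char /= ffunE.
by rewrite mulrCA divff ?cl_phase_neq0 ?mulr1.
Qed.

Lemma pullback_inj T : injective (fun chi => pullback chi T).
Proof.
move=> chi psi /= e; apply: cdualP => v.
by rewrite -[v](sympKV T) -!pullbackE e.
Qed.

End CliffordExtension.

(** * The functor F is an equivalence *)

Section AffineRepresentations.
Variables (C : numClosedFieldType) (A : finZmodType).
Local Notation V := (phase C A).
Local Notation Sp := (symp C A).
Local Notation Cl := (clifford C A).
Local Notation ASp := (affsp C A).
Implicit Types (u v w : V) (T : Sp) (c d : Cl) (chi psi : cdual C V) (g : ASp).

Section OneRepresentation.
Variables (m : nat) (Pi : mx_representation C [set: ASp] m).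

Lemma affsp_repr_split g : Pi g = rho Pi (as_symp g) *m char_op Pi (as_char g).
Proof.
case: g => T chi; rewrite -repr_mxM ?inE // affspM /affsp_mul /= mulg1.
congr (Pi (AffSp _ _)); apply: cdualP => v.
by rewrite cdual_addE pullbackE cdual_zeroE mul1r.
Qed.

Lemma weight_proj_rho T v :
  weight_proj Pi (T v) *m rho Pi T = rho Pi T *m weight_proj Pi v.
Proof.
apply: (eigenproj_intertwine (@pullback_inj C A T)) => [chi|chi].
  exact: pullbackE.
exact: char_op_rho.
Qed.

Lemma mul_weight_proj v w :
  weight_proj Pi v *m weight_proj Pi w = if w == v then weight_proj Pi v else 0.
Proof. exact: (mul_eigenproj (char_opD Pi)). Qed.

Lemma functorF_diag c :
  functorF Pi c = rho Pi (cl_symp c) *m diag_op (char_op Pi) (cl_phase c).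
Proof. by rewrite mulmx_sumr; apply: eq_bigr => v _; rewrite scalemxAr. Qed.

Lemma functorF_char chi : functorF Pi (cl_char chi) = char_op Pi chi.
Proof.
rewrite functorF_diag cl_symp_char rho1 mul1mx.
exact: (diag_op_char (char_op0 Pi) (char_opD Pi)).
Qed.

(** The phases can be divided out again, weight space by weight space, so rho is
    determined by F. *)
Lemma rho_functorF c : rho Pi (cl_symp c) =
  functorF Pi c *m diag_op (char_op Pi) (fun v => (cl_phase c v)^-1).
Proof.
rewrite functorF_diag -mulmxA (diag_opM (char_opD Pi)).
rewrite (eq_diag_op _ (h' := fun=> 1)) => [|v].
  by rewrite (diag_op1 (char_op0 Pi)) mulmx1.
by rewrite divff ?cl_phase_neq0.
Qed.
End OneRepresentation.

(** Each of the two actions is built from the other and from the weight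
    projections, which come from the characters common to both groups. *)
Lemma functorF_intertwine m m' (Pi : mx_representation C [set: ASp] m)
    (Pi' : mx_representation C [set: ASp] m') (X : 'M_(m, m')) :
  (forall g, Pi g *m X = X *m Pi' g) <->
  (forall c, functorF Pi c *m X = X *m functorF Pi' c).
Proof.
have diagX h : (forall chi, char_op Pi chi *m X = X *m char_op Pi' chi) ->
    diag_op (char_op Pi) h *m X = X *m diag_op (char_op Pi') h.
  by move=> NX; apply: (@diag_op_intertwine _ _ _ _ _ _ _ id id).
split=> [PiX c|FX g].
  rewrite !functorF_diag -mulmxA diagX => [|chi]; last exact: PiX.
  by rewrite !mulmxA; congr (_ *m _); apply: PiX.
have NX chi : char_op Pi chi *m X = X *m char_op Pi' chi.
  by rewrite -!functorF_char FX.
rewrite !affsp_repr_split -mulmxA NX !mulmxA; congr (_ *m _).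
by rewrite -(cl_liftK (as_symp g)) !rho_functorF -mulmxA diagX // !mulmxA FX.
Qed.

Lemma weight_proj_intertwine m m' (Pi : mx_representation C [set: ASp] m)
    (Pi' : mx_representation C [set: ASp] m') (X : 'M_(m, m')) v :
  (forall g, g \in [set: ASp] -> Pi g *m X = X *m Pi' g) ->
  weight_proj Pi v *m X = X *m weight_proj Pi' v.
Proof.
move=> PiX; apply: (@eigenproj_intertwine _ _ _ _ _ _ _ id) => // chi.
exact/PiX/in_setT.
Qed.

Section Inverse.
Variables (m : nat) (tau : mx_representation C [set: Cl] m).

Definition cl_char_op chi : 'M[C]_m := tau (cl_char chi).
Local Notation D := (diag_op cl_char_op).

(** The inverse of F: (T, chi) acts on the weight space at v by
    chi(v) lambda(v)^-1 tau(T, lambda), for the chosen lambda over T. *)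
Definition untwist_mx g : 'M[C]_m :=
  tau (cl_lift (as_symp g)) *m
    D (fun v => as_char g v / cl_phase (cl_lift (as_symp g)) v).

Lemma cl_char_opD chi psi :
  cl_char_op (chi + psi) = cl_char_op chi *m cl_char_op psi.
Proof. by rewrite /cl_char_op cl_charD repr_mxM ?inE. Qed.

Lemma cl_char_op0 : cl_char_op 0 = 1%:M.
Proof. by rewrite /cl_char_op cl_char0 repr_mx1. Qed.

Lemma diag_op_clifford h c : D h *m tau c = tau c *m D (h \o cl_symp c).
Proof.
apply: (diag_op_intertwine _ (@pullback_inj C A (cl_symp c))) => [|chi v|chi].
- exact: (can_inj (sympK _)).
- exact: pullbackE.
by rewrite -!repr_mxM ?inE // cl_charJ.
Qed.

(** Independence of the lift, which is what makes untwist_mx multiplicative: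
    another lift is c (1, chi), and the extra chi(v) in its phase cancels the
    scalar by which (1, chi) acts on the weight space at v. *)
Lemma untwist_mxE c g : cl_symp c = as_symp g ->
  untwist_mx g = tau c *m D (fun v => as_char g v / cl_phase c v).
Proof.
move=> cg; have [|chi ->] := @same_symp_char _ _ (cl_lift (as_symp g)) c.
  by rewrite cl_liftK.
rewrite repr_mxM ?inE // -mulmxA -[tau (cl_char chi)]/(cl_char_op chi).
rewrite -(diag_op_char cl_char_op0 cl_char_opD chi) (diag_opM cl_char_opD).
congr (_ *m _); apply: eq_diag_op => v.
rewrite cl_phaseM cl_symp_char symp1 cl_phase_char.
by field; rewrite cl_phase_neq0 cdual_neq0.
Qed.

Fact untwist_subproof : mx_repr [set: ASp] untwist_mx.
Proof.
split=> [|g h _ _].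
  rewrite (@untwist_mxE 1%g) ?cl_symp1 // repr_mx1 mul1mx.
  rewrite -(diag_op1 cl_char_op0); apply: eq_diag_op => v.
  by rewrite cl_phase1 divr1.
have cg := cl_liftK (as_symp g); have dh := cl_liftK (as_symp h).
set c := cl_lift _ in cg; set d := cl_lift _ in dh.
rewrite (@untwist_mxE (c * d)%g) ?cl_sympM ?cg ?dh //.
rewrite (untwist_mxE cg) (untwist_mxE dh) repr_mxM ?inE // -!mulmxA.
congr (_ *m _); rewrite [RHS]mulmxA diag_op_clifford -mulmxA (diag_opM cl_char_opD).
congr (_ *m _); apply: eq_diag_op => v /=.
rewrite cl_phaseM !ffunE -dh !cl_sympE.
by field; rewrite !cl_phase_neq0.
Qed.

Definition untwist := MxRepresentation untwist_subproof.

Lemma functorF_untwist c : functorF untwist c = tau c.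
Proof.
have NE : char_op untwist =1 cl_char_op.
  move=> chi; rewrite /char_op /= (@untwist_mxE 1%g) ?cl_symp1 //.
  rewrite repr_mx1 mul1mx -(diag_op_char cl_char_op0 cl_char_opD chi).
  by apply: eq_diag_op => v; rewrite [cl_phase _ _]ffunE divr1.
have -> : functorF untwist c = rho untwist (cl_symp c) *m D (cl_phase c).
  rewrite functorF_diag -[diag_op (char_op _) _]mulmx1 -[D _]mul1mx; congr (_ *m _).
  apply: (@diag_op_intertwine _ _ _ _ _ _ _ id id) => // chi.
  by rewrite NE mulmx1 mul1mx.
rewrite {1}/rho /= (@untwist_mxE c) // -mulmxA (diag_opM cl_char_opD).
rewrite (eq_diag_op _ (h' := fun=> 1)) ?(diag_op1 cl_char_op0) ?mulmx1 // => v.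
by rewrite cdual_zeroE div1r mulVf ?cl_phase_neq0.
Qed.
End Inverse.
End AffineRepresentations.

(** * Evaluation in an induced representation *)

Section InducedModule.
Variables (F : fieldType) (gT : finGroupType) (H : {group gT}) (n : nat).
Variable sigma : mx_representation F H n.
Implicit Types x y g h : gT.

Local Notation t := (@coset_rep gT H).
Local Notation ind := (induced_repr sigma).
Local Notation ext := (extend0 sigma).

Lemma extend0_mul h x : h \in H -> ext (h * x)%g = sigma h *m ext x.
Proof.
move=> hH; rewrite /extend0 groupMl //.
by case: ifP => xH; rewrite ?mulmx0 // repr_mxM.
Qed.

Lemma extend0_mulr h x : h \in H -> ext (x * h)%g = ext x *m sigma h.
Proof.
move=> hH; rewrite /extend0 groupMr //.
by case: ifP => xH; rewrite ?mul0mx // repr_mxM.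
Qed.

(** Only the coset containing x^-1 contributes, and there the summand equals
    f (x y) by equivariance.  This one summation underlies the composition rules
    for ind_row and ind_col and the intertwining property of ind_embed. *)
Lemma sum_extend0 p (f : gT -> 'M[F]_(n, p)) x y :
  (forall h z, h \in H -> f (h * z)%g = sigma h *m f z) ->
  \sum_k ext (x * t k)%g *m f ((t k)^-1 * y)%g = f (x * y)%g.
Proof.
move=> fH; have [k] := coset_rep_exists H x^-1%g.
rewrite -invMg groupV => xk; rewrite (bigD1 k) //= big1 ?addr0 => [|l lk].
  by rewrite /extend0 xk -fH // mulgA mulgK.
rewrite /extend0; case: ifP => [xl|_]; last by rewrite mul0mx.
case/eqP: lk; apply: coset_rep_inj.
by rewrite -(mulKg x (t k)) mulgA -invMg groupM ?groupV.
Qed.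

(** Vectors of the induced representation are the sigma-equivariant functions on
    G, stored by their values on coset representatives.  ind_row x evaluates such
    a function at x; ind_col x is the inclusion of the functions supported on the
    coset of x. *)
Definition ind_row x : 'M[F]_(n, \sum_(i < #|lcosets H [set: gT]|) n) :=
  \mxrow_k ext (x^-1 * t k)%g.
Definition ind_col x : 'M[F]_(\sum_(i < #|lcosets H [set: gT]|) n, n) :=
  \mxcol_k ext ((t k)^-1 * x)%g.

Lemma ind_row_repr x g : ind_row x *m ind g = ind_row (g^-1 * x)%g.
Proof.
rewrite mul_mxrow_mxblock; apply: eq_mxrow => l.
under eq_bigr do rewrite -mulgA.
by rewrite sum_extend0 => [|h z]; [rewrite invMg invgK mulgA | apply: extend0_mul].
Qed.

Lemma ind_row_mulr x h : h \in H -> ind_row (x * h)%g = sigma h^-1%g *m ind_row x.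
Proof.
move=> hH; rewrite mul_mxrow; apply: eq_mxrow => k.
by rewrite invMg -mulgA extend0_mul ?groupV.
Qed.

Lemma ind_col_mulr x h : h \in H -> ind_col (x * h)%g = ind_col x *m sigma h.
Proof.
move=> hH; rewrite mxcol_mul; apply: eq_mxcol => k.
by rewrite mulgA extend0_mulr.
Qed.

Lemma ind_rowK x : ind_row x *m ind_col x = 1%:M.
Proof.
rewrite mul_mxrow_mxcol sum_extend0 => [|h z]; last exact: extend0_mul.
by rewrite mulVg /extend0 group1 repr_mx1.
Qed.

Lemma ind_col_row x h : h \in H ->
  ind_col (x * h)%g *m ind_row (x * h)%g = ind_col x *m ind_row x.
Proof.
move=> hH; rewrite ind_col_mulr // ind_row_mulr // -mulmxA (mulmxA (sigma h)).
by rewrite -repr_mxM ?groupV // mulgV repr_mx1 mul1mx.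
Qed.

Lemma sum_ind_col_row : \sum_i ind_col (t i) *m ind_row (t i) = 1%:M.
Proof.
rewrite -(repr_mx1 ind) /= /induced_mx.
transitivity (\mxblock_(k, l) \sum_i
  (ext ((t k)^-1 * t i) *m ext ((t i)^-1 * t l))%g).
  by rewrite mxblock_sum; apply: eq_bigr => i _; rewrite mul_mxcol_mxrow.
apply: eq_mxblock => k l; rewrite sum_extend0 => [|h z]; last exact: extend0_mul.
by rewrite mulg1.
Qed.

(** Frobenius reciprocity: an H-map S between sigma and Pi extends to a G-map
    between the induced representation and Pi, given on the i-th coset by
    translating S. *)
Definition ind_embed m (Pi : mx_representation F [set: gT] m) (S : 'M_(n, m)) :
    'M[F]_(\sum_(i < #|lcosets H [set: gT]|) n, m) :=
  \mxcol_i (S *m Pi (t i)^-1%g).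

Lemma ind_embed_hom m (Pi : mx_representation F [set: gT] m) (S : 'M_(n, m)) :
  (forall h, h \in H -> sigma h *m S = S *m Pi h) ->
  forall g, ind g *m ind_embed Pi S = ind_embed Pi S *m Pi g.
Proof.
move=> SH g; rewrite mul_mxblock_mxrow mxcol_mul; apply: eq_mxcol => i.
rewrite -mulmxA -repr_mxM ?inE // -[(_^-1 * g)%g]mulg1.
rewrite -(sum_extend0 (f := fun x => S *m Pi x)) => [|h z hH].
  by apply: eq_bigr => k _; rewrite !mulg1.
by rewrite repr_mxM ?inE // !mulmxA SH.
Qed.
End InducedModule.

(** * Weight spaces of the induced representations *)

Section InducedWeights.
Variables (C : numClosedFieldType) (A : finZmodType) (u : phase C A) (n : nat).
Variable sigma : mx_representation C (symp_stab_group u) n.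
Local Notation V := (phase C A).
Local Notation Sp := (symp C A).
Local Notation ASp := (affsp C A).
Local Notation H := (affsp_stab_group u).
Local Notation t := (@coset_rep (affsp C A) (affsp_stab_group u)).
Local Notation ind := (induced_repr (inflate sigma)).
Local Notation row := (ind_row (inflate sigma)).
Local Notation col := (ind_col (inflate sigma)).
Implicit Types (v w : V) (T R : Sp) (chi psi : cdual C V) (x y g : ASp).

Lemma affsp_stab_coset x y :
  ((x^-1 * y)%g \in affsp_stab u) = (as_symp y u == as_symp x u).
Proof.
rewrite !inE -(inj_eq (can_inj (sympK (as_symp x)))) sympM.
by rewrite -[as_symp x^-1%g]/((as_symp x)^-1)%g sympKV.
Qed.

Lemma affsp_charJ chi x :
  (AffSp 1%g chi * x)%g = (x * AffSp 1%g (pullback chi (as_symp x)))%g.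
Proof.
rewrite !affspM /affsp_mul /= mul1g mulg1; congr AffSp; apply: cdualP => v.
by rewrite !(cdual_addE, pullbackE) symp1 mulrC.
Qed.

Lemma affsp_sympM T R : AffSp (T * R)%g 0 = (AffSp T 0 * AffSp R 0)%g.
Proof.
rewrite affspM /affsp_mul; congr AffSp; apply: cdualP => v.
by rewrite cdual_addE pullbackE !cdual_zeroE mulr1.
Qed.

Lemma affsp_sympV T : AffSp T^-1%g 0 = (AffSp T 0)^-1%g.
Proof. by apply/eqP; rewrite eq_sym eq_invg_mul -affsp_sympM mulgV. Qed.

(** Moving (1, chi) past x turns it into (1, chi o T) with T the linear part of
    x, and this lies in the inducing subgroup, where it acts as chi(T u).  So the
    coset of x carries the weight T u. *)
Lemma ind_row_char x chi :
  row x *m char_op ind chi = chi (as_symp x u) *: row x.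
Proof.
set k := AffSp 1%g (pullback chi (as_symp x)).
have kH : k \in H by rewrite inE /= group1.
rewrite /char_op ind_row_repr.
have -> : ((AffSp 1%g chi)^-1 * x = x * k^-1)%g.
  by rewrite -[x in LHS](mulgK k) -affsp_charJ mulgA mulKg.
rewrite ind_row_mulr ?groupV // invgK /= repr_mx1.
by rewrite pullbackE -scalemxAl mul1mx.
Qed.

Lemma ind_row_proj x v :
  row x *m weight_proj ind v = if v == as_symp x u then row x else 0.
Proof.
by apply: (eigenrow_proj (N := char_op ind)) => chi; apply: ind_row_char.
Qed.

(** Distinct cosets of the stabiliser of u have distinct weights, so each weight
    space is supported on a single coset. *)
Lemma weight_proj_ind x : weight_proj ind (as_symp x u) = col x *m row x.
Proof.
have [j jx] := coset_rep_exists (affsp_stab_group u) x.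
rewrite -[LHS]mul1mx -(sum_ind_col_row (inflate sigma)) mulmx_suml [LHS](bigD1 j) //=.
rewrite -mulmxA ind_row_proj; move: (jx); rewrite affsp_stab_coset => /eqP xj.
rewrite xj eqxx.
rewrite [X in _ + X]big1 ?addr0 => [|i ij].
  by rewrite -(ind_col_row _ (t j) jx) mulVKg.
rewrite -mulmxA ind_row_proj; case: ifP => xi; last exact: mulmx0.
case/eqP: ij; apply: (@coset_rep_inj _ (affsp_stab_group u)).
by rewrite affsp_stab_coset.
Qed.

(** Evaluation at T identifies the weight space at v = T u with the conjugate of
    sigma by T, as representations of Sp(V)_v. *)
Lemma ind_row_rho T v (Tu : T u = v) R : R \in symp_stab v ->
  row (AffSp T 0) *m rho ind R = twist Tu sigma R *m row (AffSp T 0).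
Proof.
rewrite inE => /eqP Rv; set x := AffSp T 0; set r := AffSp R 0.
have kH : (x^-1 * r * x)%g \in H.
  rewrite -mulgA affsp_stab_coset -[as_symp (r * x)%g]/(R * T)%g.
  by rewrite sympM /= Tu Rv.
rewrite /rho ind_row_repr.
have -> : (r^-1 * x = x * (x^-1 * r * x)^-1)%g.
  by rewrite !invMg invgK !mulgA mulgV mul1g.
rewrite ind_row_mulr ?groupV // invgK; congr (_ *m _).
have -> : (x^-1 * r * x = AffSp (T^-1 * R * T) 0)%g.
  by rewrite /x /r -affsp_sympV -!affsp_sympM.
by rewrite /= cdual_zeroE scale1r.
Qed.

Section Embedding.
Variables (m : nat) (Pi : mx_representation C [set: ASp] m) (S : 'M[C]_(n, m)).
Hypothesis Su : S *m weight_proj Pi u = S.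

(** On a weight space at u the characters act as the inflation prescribes, so
    equivariance under Sp(V)_u is all that Frobenius reciprocity asks for. *)
Lemma weight_embed_hom :
  (forall R, R \in symp_stab u -> sigma R *m S = S *m rho Pi R) ->
  forall g, ind g *m ind_embed H Pi S = ind_embed H Pi S *m Pi g.
Proof.
move=> SR; apply: ind_embed_hom => h; rewrite inE => hu /=.
rewrite affsp_repr_split mulmxA -SR // -mulmxA -scalemxAl scalemxAr; congr (_ *m _).
rewrite -Su -mulmxA scalemxAr; congr (_ *m _).
by rewrite (char_eigenproj (char_opD Pi)).
Qed.

Lemma weight_proj_repr g v :
  weight_proj Pi (as_symp g v) *m Pi g = Pi g *m weight_proj Pi v.
Proof.
rewrite affsp_repr_split mulmxA weight_proj_rho -!mulmxA; congr (_ *m _).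
rewrite (char_eigenproj (char_opD Pi)).
by rewrite (eigenproj_char (char_opD Pi)).
Qed.

(** The block of the i-th coset lies in the weight space at t_i u, and these
    weights are distinct.  Projecting to the weight space at t_j u, translating
    back and applying a right inverse of S therefore gives a right inverse of
    the whole map. *)
Lemma weight_embed_free : row_free S -> row_free (ind_embed H Pi S).
Proof.
move=> /row_freeP[S' SS']; apply/row_freeP.
exists (\mxrow_j (weight_proj Pi (as_symp (t j) u) *m Pi (t j) *m S')).
rewrite mul_mxcol_mxrow -mxdiagZ; apply: eq_mxblock => i j.
rewrite weight_proj_repr -!mulmxA; case: eqVneq => [<-|ij].
  rewrite conform_mx_id (mulmxA (Pi _)) -repr_mxM ?inE // mulVg repr_mx1 mul1mx.
  by rewrite mulmxA Su.
rewrite (mulmxA (Pi _)) -repr_mxM ?inE // (mulmxA (Pi _)) -weight_proj_repr.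
rewrite -{1}Su -!mulmxA (mulmxA (weight_proj Pi u)) mul_weight_proj.
case: eqP => [e|_]; last by rewrite mul0mx mulmx0.
case/eqP: ij; apply: (@coset_rep_inj _ (affsp_stab_group u)).
by rewrite !inE; apply/eqP; exact: e.
Qed.
End Embedding.
End InducedWeights.

Lemma mx_rsim_inv (F : fieldType) (gT : finGroupType) (G : {group gT}) n1 n2
    (rG1 : mx_representation F G n1) (rG2 : mx_representation F G n2) :
  mx_rsim rG1 rG2 -> exists B B',
    [/\ B *m B' = 1%:M, B' *m B = 1%:M &
        forall x, x \in G -> rG1 x *m B = B *m rG2 x].
Proof.
case/mx_rsim_def=> B [B' B'B BP]; exists B, B'; split=> // [|x Gx].
  by have := BP 1%g (group1 G); rewrite !repr_mx1 mulmx1 => <-.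
by rewrite BP // -mulmxA B'B mulmx1.
Qed.

(** * Comparing induced representations *)

(** The data r, c present the image of a projection P = c r as a space of
    smaller dimension.  An isomorphism B that matches two such projections
    restricts to an isomorphism between their images. *)
Section Compression.
Variables (F : fieldType) (N1 N2 n1 n2 : nat).
Variables (B : 'M[F]_(N1, N2)) (B' : 'M[F]_(N2, N1)).
Hypotheses (BB' : B *m B' = 1%:M) (B'B : B' *m B = 1%:M).
Variables (P1 : 'M[F]_N1) (r2 : 'M[F]_(n2, N2)) (c2 : 'M[F]_(N2, n2)).
Hypotheses (P1B : P1 *m B = B *m (c2 *m r2)) (r2K : r2 *m c2 = 1%:M).

Lemma transported_proj_neq0 : (0 < n2)%N -> P1 != 0.
Proof.
move=> n2_gt0; apply/eqP=> P10.
have : r2 *m (B' *m (P1 *m B)) *m c2 = 1%:M.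
  by rewrite P1B (mulmxA B') B'B mul1mx (mulmxA r2) r2K mul1mx r2K.
rewrite P10 mul0mx !mulmx0 mul0mx => /(congr1 mxrank).
by rewrite mxrank0 mxrank1 => n20; rewrite -n20 in n2_gt0.
Qed.

Variables (r1 : 'M[F]_(n1, N1)) (c1 : 'M[F]_(N1, n1)).
Hypotheses (P1E : P1 = c1 *m r1) (r1K : r1 *m c1 = 1%:M).

Lemma mx_rsim_compression (gT : finGroupType) (G : {group gT})
    (sigma1 : mx_representation F G n1) (sigma2 : mx_representation F G n2)
    (rho1 : gT -> 'M[F]_N1) (rho2 : gT -> 'M[F]_N2) :
  (forall x, x \in G -> rho1 x *m B = B *m rho2 x) ->
  (forall x, x \in G -> r1 *m rho1 x = sigma1 x *m r1) ->
  (forall x, x \in G -> rho2 x *m c2 = c2 *m sigma2 x) ->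
  mx_rsim sigma1 sigma2.
Proof.
move=> rhoB r1rho rho2c.
have MM' : (r1 *m B *m c2) *m (r2 *m B' *m c1) = 1%:M.
  rewrite !mulmxA -(mulmxA _ c2) -(mulmxA r1) -P1B -!mulmxA (mulmxA B) BB' mul1mx.
  by rewrite P1E !mulmxA r1K mul1mx r1K.
have M'M : (r2 *m B' *m c1) *m (r1 *m B *m c2) = 1%:M.
  rewrite !mulmxA -(mulmxA _ c1) -P1E -(mulmxA _ P1) P1B.
  by rewrite -!mulmxA r2K mulmx1 (mulmxA B') B'B mul1mx r2K.
exists (r1 *m B *m c2) => [||x Gx].
- by apply/anti_leq; rewrite (mulmx1_min MM') (mulmx1_min M'M).
- by apply/row_freeP; exists (r2 *m B' *m c1).
by rewrite !mulmxA -r1rho // -(mulmxA r1 (rho1 x)) rhoB // -!mulmxA rho2c.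
Qed.
End Compression.

Section InducedWeightSpace.
Variables (C : numClosedFieldType) (A : finZmodType) (u : phase C A) (n : nat).
Variable sigma : mx_representation C (symp_stab_group u) n.
Local Notation ind := (induced_repr (inflate sigma)).
Local Notation row T := (ind_row (inflate sigma) (AffSp T 0)).
Local Notation col T := (ind_col (inflate sigma) (AffSp T 0)).
Implicit Types (v : phase C A) (T R : symp C A).

(** The weights of the representation induced from (u, sigma) lie in the orbit
    of u. *)
Lemma weight_proj_ind_neq0 v :
  weight_proj ind v != 0 -> exists T : symp C A, T u = v.
Proof.
pose t := @coset_rep (affsp C A) (affsp_stab_group u).
case: (pickP (fun i => v == as_symp (t i) u)) => [i /eqP-> _|t_v /eqP[]].
  by exists (as_symp (t i)).
rewrite -[LHS]mul1mx -(sum_ind_col_row (inflate sigma)) mulmx_suml [LHS]big1 // => i _.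
by rewrite -mulmxA ind_row_proj t_v mulmx0.
Qed.

Lemma weight_proj_ind_at T v : T u = v -> weight_proj ind v = col T *m row T.
Proof. by move=> <-; rewrite -weight_proj_ind. Qed.

Lemma ind_col_rho T v (Tu : T u = v) R : R \in symp_stab v ->
  rho ind R *m col T = col T *m twist Tu sigma R.
Proof.
move=> Rv; have Pv : weight_proj ind v = col T *m row T.
  exact: weight_proj_ind_at.
have Pcol : weight_proj ind v *m col T = col T.
  by rewrite Pv -mulmxA ind_rowK mulmx1.
have Rvv : R v = v by move: Rv; rewrite inE => /eqP.
have comm_Pv : rho ind R *m weight_proj ind v = weight_proj ind v *m rho ind R.
  by rewrite -weight_proj_rho Rvv.
rewrite -{1}Pcol mulmxA comm_Pv Pv -!mulmxA (mulmxA (row T)) (ind_row_rho _ Tu) //.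
by rewrite -(mulmxA _ (row T)) ind_rowK mulmx1.
Qed.
Lemma ind_col_rho1 R : R \in symp_stab u ->
  rho ind R *m col 1%g = col 1%g *m sigma R.
Proof.
move=> Ru; rewrite (ind_col_rho (symp1 u) Ru) /=.
by rewrite invg1 mul1g mulg1.
Qed.
End InducedWeightSpace.

Section Classification.
Variables (C : numClosedFieldType) (A : finZmodType).
Local Notation V := (phase C A).
Local Notation Sp := (symp C A).
Local Notation ASp := (affsp C A).
Local Notation Cl := (clifford C A).
Implicit Types p q : affine_param C A.

Lemma mx_rsim_functorF m m' (Pi : mx_representation C [set: ASp] m)
    (Pi' : mx_representation C [set: ASp] m') :
  mx_rsim Pi Pi' <-> mx_rsim (functorF Pi) (functorF Pi').
Proof.
split=> -[X mm' Xfree XP]; exists X => //.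
  move=> c _; apply: (functorF_intertwine Pi Pi' X).1 => g.
  by apply: XP; rewrite inE.
move=> g _; apply: (functorF_intertwine Pi Pi' X).2 => c.
by apply: XP; rewrite inE.
Qed.

Lemma affine_param_equiv_sym p q : affine_param_equiv p q -> affine_param_equiv q p.
Proof.
case=> T [Tp [B nn Bfree BT]].
have Tq : T^-1%g (ap_pt q) = ap_pt p by rewrite -Tp sympK.
exists T^-1%g, Tq; apply: mx_rsim_sym; exists B => // R Rp.
rewrite /= invgK BT /= ?mulgA ?mulVg ?mul1g ?mulgKV //.
by rewrite inE !sympM Tq; move: Rp; rewrite inE => /eqP->; rewrite Tp.
Qed.

(** The weight space at T u of the representation induced from p contains a copy
    of the representation of q, so the general embedding applies to it. *)
Lemma affine_param_equiv_embed p q : affine_param_equiv p q ->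
  exists2 Z : 'M_(rdegree (affPi q), rdegree (affPi p)),
    row_free Z & forall g, affPi q g *m Z = Z *m affPi p g.
Proof.
case=> T [Tp [B _ /row_freeP[B' BB'] BT]].
pose S := B *m ind_row (inflate (ap_rep p)) (AffSp T 0).
have Sq : S *m weight_proj (affPi p) (ap_pt q) = S.
  by rewrite -mulmxA ind_row_proj /= Tp eqxx.
exists (ind_embed (affsp_stab_group (ap_pt q)) (affPi p) S).
  apply: weight_embed_free => //; apply/row_freeP.
  exists (ind_col (inflate (ap_rep p)) (AffSp T 0) *m B').
  by rewrite -mulmxA (mulmxA (ind_row _ _)) ind_rowK mul1mx.
apply: weight_embed_hom => // R Rq.
by rewrite mulmxA BT // -!mulmxA (ind_row_rho _ Tp).
Qed.

(** Embeddings in both directions force equal dimensions, which makes either of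
    them an isomorphism. *)
Lemma affPi_rsim_equiv p q : affine_param_equiv p q -> mx_rsim (affPi p) (affPi q).
Proof.
move=> pq; have [Z Zfree ZP] := affine_param_equiv_embed (affine_param_equiv_sym pq).
have [Z' Z'free _] := affine_param_equiv_embed pq.
exists Z; [apply/anti_leq/andP; split | exact: Zfree | by move=> g _; apply: ZP].
  by move: Zfree => /eqP <-; apply: rank_leq_col.
by move: Z'free => /eqP <-; apply: rank_leq_col.
Qed.

(** The representation induced from q has weight v, the point of q, with weight
    space the representation of q.  The isomorphism transports this to the one
    induced from p: so v = T u lies in the orbit of the point u of p, and the
    weight space there is the conjugate by T of the representation of p. *)
Lemma equiv_affPi_rsim p q : mx_rsim (affPi p) (affPi q) -> affine_param_equiv p q.
Proof.
move/mx_rsim_inv=> [B [B' [BB' B'B BP]]]; set u := ap_pt p; set v := ap_pt q.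
have BPv := etrans (weight_proj_intertwine v BP)
  (congr1 (mulmx B) (weight_proj_ind_at (ap_rep q) (symp1 v))).
(* The identity presents the weight space of q at its own point. *)
have rqK := ind_rowK (inflate (ap_rep q)) (AffSp 1%g 0).
have [n_gt0 _] := (mx_irrP _).1 (ap_irr q).
have /weight_proj_ind_neq0[T Tp] := transported_proj_neq0 B'B BPv rqK n_gt0.
exists T, Tp; apply: mx_rsim_sym.
apply: (mx_rsim_compression BB' B'B BPv rqK (weight_proj_ind_at (ap_rep p) Tp)
  (ind_rowK _ _) (rho1 := rho (affPi p)) (rho2 := rho (affPi q))) => R Rv.
- exact/BP/in_setT.
- exact: ind_row_rho.
exact: ind_col_rho1.
Qed.
End Classification.

(** * Dimensions and exhaustion *)

Section Exhaustion.
Variables (C : numClosedFieldType) (A : finZmodType).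
Local Notation Sp := (symp C A).
Local Notation ASp := (affsp C A).

Lemma card_affsp_over (K : {set Sp}) :
  #|[set g : ASp | as_symp g \in K]| = (#|K| * #|{: cdual C (phase C A)}|)%N.
Proof.
pose f (x : Sp * cdual C (phase C A)) : ASp := AffSp x.1 x.2.
have f_inj : injective f by move=> [T chi] [S psi] [-> ->].
rewrite -[#|{: _}|]cardsT -cardsX -(card_imset _ f_inj); congr #|pred_of_set _|.
apply/setP=> -[T chi]; rewrite inE /=; apply/idP/imsetP => [TK|[[S psi]]].
  by exists (T, chi); rewrite // !inE TK.
by rewrite !inE andbT /= => SK [-> _].
Qed.

Lemma index_affsp_stab (u : phase C A) :
  #|[set: ASp] : affsp_stab u|%g = #|[set: Sp] : symp_stab u|%g.
Proof.
have dual_gt0 : (0 < #|{: cdual C (phase C A)}|)%N by apply: finzmod_gt0.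
have stab_gt0 : (0 < #|symp_stab u|)%N by apply: (cardG_gt0 (symp_stab_group u)).
have LSp := Lagrange (subsetT (symp_stab_group u)).
have LASp := Lagrange (subsetT (affsp_stab_group u)).
apply/eqP; rewrite -(eqn_pmul2l (cardG_gt0 (affsp_stab_group u))) LASp /=.
rewrite card_affsp_over mulnAC LSp -card_affsp_over.
by apply/eqP/eq_card => g; rewrite !inE.
Qed.

Lemma rdegree_cliffordPi (p : affine_param C A) : rdegree (cliffordPi p) =
  (#|[set: Sp] : symp_stab (ap_pt p)|%g * rdegree (ap_rep p))%N.
Proof.
by rewrite /= sum_nat_const card_ord card_lcosets index_affsp_stab.
Qed.

(** The action of Sp(V)_u on the whole space of Pi; the weight space at u is a
    submodule of it, from which the little representation is taken. *)
Section WeightRepresentation.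
Variables (m : nat) (Pi : mx_representation C [set: ASp] m) (u : phase C A).

Fact rho_stab_subproof : mx_repr (symp_stab_group u) (rho Pi).
Proof. by split=> [|T S _ _]; [apply: rho1 | apply: rhoM]. Qed.
Definition rho_stab := MxRepresentation rho_stab_subproof.

Lemma weight_proj_module : mxmodule rho_stab (weight_proj Pi u).
Proof.
apply/mxmoduleP=> R; rewrite inE => /eqP Ru.
by rewrite -{1}Ru /= weight_proj_rho submxMl.
Qed.
End WeightRepresentation.

(** Take a weight u that occurs and a simple constituent U of its weight space
    under Sp(V)_u.  The induced map Z is injective, and its image is a nonzero
    submodule of the irreducible tau, hence everything. *)
Lemma clifford_irr_exhaustion (tau : representation C [set: clifford C A]) :
  mx_irreducible tau -> exists p : affine_param C A, mx_rsim (cliffordPi p) tau.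
Proof.
move=> /mx_irrP[m_gt0 tau_irr]; pose Pi := untwist tau.
have [u Pu0] : exists u, weight_proj Pi u != 0.
  apply/existsP; apply: contraLR m_gt0 => /existsPn /= P0.
  have := sum_weight_proj Pi; rewrite big1 => [|v _].
    by move/(congr1 mxrank); rewrite mxrank0 mxrank1 => <-.
  by apply/eqP; rewrite -[_ == _]negbK.
have [U simU sUP] := dec_mxsimple_exists (weight_proj_module Pi u) Pu0.
pose sigma := submod_repr (mxsimple_module simU).
pose p := @AffineParam C A u (Representation sigma) ((submod_mx_irr _).2 simU).
exists p.
pose S : 'M_(\rank U, rdegree tau) := val_submod 1%:M.
have SP : S *m weight_proj Pi u = S.
  have /submxP[X ->] : (S <= weight_proj Pi u)%MS by rewrite val_submod1.
  by rewrite -mulmxA mul_weight_proj eqxx.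
have SR R : R \in symp_stab u -> sigma R *m S = S *m rho Pi R.
  move=> Ru; rewrite -(val_submodJ (mxsimple_module simU)) // mul1mx.
  by rewrite /S -val_submodE.
pose Z := ind_embed (affsp_stab_group u) Pi S.
have Zfree : row_free Z.
  by apply: weight_embed_free => //; rewrite /row_free val_submod1.
have Zhom c : cliffordPi p c *m Z = Z *m tau c.
  rewrite -(functorF_untwist tau); move: c.
  exact/functorF_intertwine/weight_embed_hom.
have Zmod : mxmodule tau <<Z>>%MS.
  by apply/mxmoduleP=> c _; rewrite (eqmxMr _ (genmxE _)) genmxE -Zhom submxMl.
have Z0 : <<Z>>%MS != 0.
  rewrite -mxrank_eq0 genmxE (eqP Zfree) -lt0n.
  apply: leq_trans (mulmx1_min (ind_rowK (inflate sigma) 1%g)).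
  by rewrite lt0n mxrank_eq0; have [] := simU.
exists Z => [||c _]; [| exact: Zfree | exact: Zhom].
by move: (tau_irr _ Zmod Z0); rewrite /row_full genmxE (eqP Zfree) => /eqP.
Qed.
End Exhaustion.

Theorem theorem4p1 (R : realType) (A : finZmodType) :
  (forall tau : representation R[i] [set: clifford R[i] A],
     mx_irreducible tau ->
     exists p : affine_param R[i] A,
       mx_rsim tau (cliffordPi p) /\
       (forall q : affine_param R[i] A,
          mx_rsim tau (cliffordPi q) <-> affine_param_equiv p q)) /\
  (forall p : affine_param R[i] A,
     rdegree (cliffordPi p) =
     (#|[set: symp R[i] A] : symp_stab (ap_pt p)|%g * rdegree (ap_rep p))%N).
Proof.
split=> [tau tau_irr|p]; last exact: rdegree_cliffordPi.
have [p tau_p] := clifford_irr_exhaustion tau_irr.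
exists p; split=> [|q]; first exact: mx_rsim_sym tau_p.
split=> [tau_q|pq].
  exact/equiv_affPi_rsim/mx_rsim_functorF/(mx_rsim_trans tau_p tau_q).
exact/(mx_rsim_trans (mx_rsim_sym tau_p))/mx_rsim_functorF/affPi_rsim_equiv.
Qed.
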